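(* Let $E,A\in C(\mathbb I,\mathbb R^{n,n})$ be sufficiently smooth, and let the pair $(E,A)$ be regular and skew-adjoint. Then there exist pairwise disjoint open intervals $\mathbb I_j$, $j\in\mathbb N$, with $\overline{\bigcup_{j}\mathbb I_j}=\mathbb I$, such that on every $\mathbb I_j$ there exists a pointwise nonsingular, continuously differentiable $Q$ with $$\bigl(Q^TEQ,\ Q^TAQ-Q^TE\dot Q\bigr)=\left(\begin{bmatrix}*&*&*&E_{14}\\ *&S&0&0\\ *&0&0&0\\ E_{41}&0&0&0\end{bmatrix},\ \begin{bmatrix}*&*&*&A_{14}\\ *&J&0&0\\ *&0&\Sigma_{22}&0\\ A_{41}&0&0&0\end{bmatrix}\right),$$ where $*$ denotes unspecified blocks, and: (i) $E_{14}$ and $A_{14}$ are partitioned into $w\times w$ blocks $E_{14}=[E^{(ik)}]$, $A_{14}=[A^{(ik)}]$ (for some $w\ge0$) such that $E^{(ik)}=0$ whenever $i+k\ge w+1$, $A^{(ik)}=0$ whenever $i+k> w+1$, and $A^{(ik)}=I$ (a square identity block) whenever $i+k=w+1$; the remaining blocks are unspecified; (ii) $\Sigma_{22}$ is pointwise nonsingular; (iii) $S=\begin{bmatrix}I_p&0\\0&-I_q\end{bmatrix}$ for some $p,q\ge0$, $J^T=-J$, $\Sigma_{22}^T=-\Sigma_{22}$, and $A_{41}^T=-A_{14}-\dot E_{14}$.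
   Context: Let $\mathbb I\subseteq\mathbb R$ be a compact non-trivial interval. We consider linear DAEs $E(t)\dot x=A(t)x+f(t)$ with $E,A\in C(\mathbb I,\mathbb R^{n,n})$; ''sufficiently smooth'' means the functions are continuously differentiable as often as needed. The pair $(E,A)$ (and the DAE) is called regular if (i) the DAE is solvable for every sufficiently smooth $f$, (ii) the solution is unique for every $t_0\in\mathbb I$ and every $x_0\in\mathbb R^n$ for which the DAE has a solution with $x(t_0)=x_0$, and (iii) the solution depends smoothly on $f$, $t_0$, $x_0$. A pair $(E,A)$ is called skew-adjoint if $E^T=E$ and $A^T=-A-\dot E$ as equalities of functions. *)

(* Defs.v *)
From HB Require Import structures.
From mathcomp Require Import all_boot all_order all_algebra.
From mathcomp Require Import all_classical all_reals all_analysis.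
Set Implicit Arguments. Unset Strict Implicit. Unset Printing Implicit Defensive.
Import Order.TTheory GRing.Theory Num.Theory.
Import numFieldNormedType.Exports.
Local Open Scope classical_set_scope.
Local Open Scope ring_scope.

Section Defs.
Variable R : realType.

Fixpoint iterD (V W : normedModType R) (vs : seq V) (f : V -> W) : V -> W :=
  if vs is v :: vs' then 'D_v (iterD vs' f) else f.

Definition smooth (V W : normedModType R) (f : V -> W) : Prop :=
  forall vs : seq V,
    continuous (iterD vs f) /\ forall (x v : V), derivable (iterD vs f) x v.

Definition C1 (V : normedModType R) (x : R -> V) : Prop :=
  (forall t, derivable x t 1) /\ continuous (derive1 x).

(** x is a (classical, C^1) solution on I = [a,b] of  E x' = A x + f.
    Functions on I are represented by functions on R (only values on I matter);
    a C^1 function on the compact interval I is the same as the restriction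
    of a C^1 function on R. *)
Definition dae_sol (n : nat) (a b : R) (E A : R -> 'M[R]_n)
    (f x : R -> 'cV[R]_n) : Prop :=
  C1 x /\ forall t, a <= t <= b -> E t *m derive1 x t = A t *m x t + f t.

Definition regular_pair (n : nat) (a b : R) (E A : R -> 'M[R]_n) : Prop :=
  (forall f : R -> 'cV[R]_n, smooth f -> exists x, dae_sol a b E A f x) /\
  (forall (f x y : R -> 'cV[R]_n) (t0 : R), smooth f ->
     dae_sol a b E A f x -> dae_sol a b E A f y -> a <= t0 <= b ->
     x t0 = y t0 -> forall t, a <= t <= b -> x t = y t) /\
  (* (iii) smooth dependence on f, t0, x0: along every smooth family
     s |-> (f_s, t0(s), x0(s)) of consistent data, the solutions x_s(t)
     depend smoothly on (s,t). *)
  (forall (F : R -> R -> 'cV[R]_n) (T0 : R -> R) (X0 : R -> 'cV[R]_n)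
          (X : R -> R -> 'cV[R]_n),
     smooth (fun st : R * R => F st.1 st.2) -> smooth T0 -> smooth X0 ->
     (forall s, a <= T0 s <= b) ->
     (forall s, dae_sol a b E A (F s) (X s) /\ X s (T0 s) = X0 s) ->
     exists G : R * R -> 'cV[R]_n, smooth G /\
       forall s t, a <= t <= b -> G (s, t) = X s t).

Definition skew_adjoint (n : nat) (a b : R) (E A : R -> 'M[R]_n) : Prop :=
  forall t, a <= t <= b -> (E t)^T = E t /\ (A t)^T = - A t - derive1 E t.

Definition ent (m1 m2 : nat) (M : 'M[R]_(m1, m2)) (i j : nat) : R :=
  match @insub _ (fun k => k < m1)%N 'I_m1 i, @insub _ (fun k => k < m2)%N 'I_m2 j with
  | Some i', Some j' => M i' j'
  | _, _ => 0
  end.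

Definition blk (m1 m2 : nat) (M : 'M[R]_(m1, m2)) (r0 c0 k1 k2 : nat)
  : 'M[R]_(k1, k2) := \matrix_(u < k1, v < k2) ent M (r0 + u) (c0 + v).

(** The normal form of Theorem 4.3 for the pair
    (Et, At) = (Q^T E Q, Q^T A Q - Q^T E Q') at one time point, where dEt is
    the derivative of Q^T E Q at that point.  Block rows/columns have sizes
    n1, p+q, n3, n4; E14 and A14 are split into w x w blocks with row sizes
    rs 0, ..., rs (w-1) and column sizes cs 0, ..., cs (w-1)
    (0-based block indices i, k; the paper's i+k (1-based) is i+k+2). *)
Definition normal_form (n n1 p q n3 n4 w : nat) (rs cs : nat -> nat)
    (Et At dEt : 'M[R]_n) : Prop :=
  let n2 := (p + q)%N in
  let o2 := n1 in let o3 := (n1 + n2)%N in let o4 := (n1 + n2 + n3)%N in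
  let E14 := blk Et 0 o4 n1 n4 in
  let A14 := blk At 0 o4 n1 n4 in
  let A41 := blk At o4 0 n4 n1 in
  let dE14 := blk dEt 0 o4 n1 n4 in
  let J := blk At o2 o2 n2 n2 in
  let Sigma := blk At o3 o3 n3 n3 in
  let ro i := (\sum_(l < i) rs l)%N in
  let co k := (\sum_(l < k) cs l)%N in
  blk Et o2 o2 n2 n2 = block_mx 1%:M 0 0 (- 1%:M) /\
  blk Et o2 o3 n2 n3 = 0 /\ blk Et o2 o4 n2 n4 = 0 /\
  blk Et o3 o2 n3 n2 = 0 /\ blk Et o3 o3 n3 n3 = 0 /\ blk Et o3 o4 n3 n4 = 0 /\
  blk Et o4 o2 n4 n2 = 0 /\ blk Et o4 o3 n4 n3 = 0 /\ blk Et o4 o4 n4 n4 = 0 /\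
  blk At o2 o3 n2 n3 = 0 /\ blk At o2 o4 n2 n4 = 0 /\
  blk At o3 o2 n3 n2 = 0 /\ blk At o3 o4 n3 n4 = 0 /\
  blk At o4 o2 n4 n2 = 0 /\ blk At o4 o3 n4 n3 = 0 /\ blk At o4 o4 n4 n4 = 0 /\
  J^T = - J /\ Sigma^T = - Sigma /\ A41^T = - A14 - dE14 /\
  Sigma \in unitmx /\
  (forall i k : nat, (i < w)%N -> (k < w)%N ->
     (w <= i + k + 1)%N -> blk E14 (ro i) (co k) (rs i) (cs k) = 0) /\
  (forall i k : nat, (i < w)%N -> (k < w)%N ->
     (w < i + k + 1)%N -> blk A14 (ro i) (co k) (rs i) (cs k) = 0) /\
  (forall i k : nat, (i < w)%N -> (k < w)%N -> (i + k + 1)%N = w ->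
     rs i = cs k /\
     blk A14 (ro i) (co k) (rs i) (cs k)
       = \matrix_(u < rs i, v < cs k) ((u : nat) == v)%:R).

End Defs.

(* Main.v *)
(* "Zero on a subinterval or invertible on a subinterval" makes smooth
   functions behave like a field as long as one may shrink the interval, so
   smooth Gaussian elimination brings the pair, on some subinterval of any
   given interval, to the form E = diag(S, 0, 0) with
   A = [*, 0, M; 0, Sigma, 0; -M^T, 0, 0], where Sigma is invertible.  If M had
   a kernel, a bump function times a kernel field would be a nonzero solution
   of the homogeneous equation vanishing near the endpoints, against uniqueness.
   Hence M has full column rank, and splitting the range of M off from a
   complement Z leaves a smaller skew-adjoint pair on Z, to which the argument
   applies again; each round adds one border to the anti-triangular blocks E14
   and A14.  The intervals are finally picked greedily inside the rational
   intervals, which keeps them disjoint and makes their union dense. *)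
Require Import Defs.
From HB Require Import structures.
From mathcomp Require Import all_boot all_order all_algebra.
From mathcomp Require Import all_classical all_reals all_analysis.
From mathcomp Require Import zify ring.
Import Order.TTheory GRing.Theory Num.Theory.
Import numFieldNormedType.Exports.
Local Open Scope classical_set_scope.
Local Open Scope ring_scope.
Set Implicit Arguments. Unset Strict Implicit. Unset Printing Implicit Defensive.

(** * Smooth scalar functions *)

(** Ranks and inertia may jump, so nothing is diagonalised by eigenvectors. A symmetric matrix
    function is pivoted along a constant vector, on an open set where the pivot keeps its sign; this
    gives a smooth frame with constant [p] and [q]. Skew and rectangular functions M are brought to
    that case through M^T M, which over the reals has the same kernel as M. Everything is phrased
    with rectangular frames, that is, groups of columns of the future [Q], and the blocks [eF] and
    [aF] that they produce; [Q] is assembled only at the end. Coefficients and frames are infinitely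
    differentiable on the current open set, whereas candidate solutions carry a finite class. A
    solution z of the reduced pair lifts to x = Z z + V v where v involves the derivative of z, so
    uniqueness in class m+1 yields uniqueness of the reduced pair in class m+2 only. Finite classes
    also allow an elementary bump, a power cut off at zero, in place of an exponential one. *)

Section ScalarSmoothness.
Variable R : realType.
Implicit Types (U : set R) (f g : R -> R).

(* Only differentiability is recorded: [ck 0] is vacuous, and the k-th
   derivative need not be continuous. *)
Fixpoint ck k U f : Prop :=
  if k is k'.+1 then (forall t, U t -> derivable f t 1) /\ ck k' U (derive1 f)
  else True.

Lemma is_derive1P (V : normedModType R) (f : R -> V) (t : R) (l : V) :
  is_derive t 1 f l <-> derivable f t 1 /\ derive1 f t = l.
Proof.
by rewrite derive1E; split=> [[df <-]|[df <-]] //; split.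
Qed.

Lemma near_open U (P : R -> Prop) t :
  open U -> U t -> (forall s, U s -> P s) -> \near t, P t.
Proof. by move=> oU Ut UP; apply: filterS UP _; exact: open_nbhs_nbhs. Qed.

Lemma eq_open_is_derive (V : normedModType R) (f g : R -> V) U (t : R) (l : V) :
  open U -> U t -> (forall s, U s -> f s = g s) ->
  is_derive t 1 f l -> is_derive t 1 g l.
Proof.
by move=> oU Ut fg; apply: near_eq_is_derive; apply: near_open fg.
Qed.

Lemma eq_open_derive1 (V : normedModType R) (f g : R -> V) U (t : R) :
  open U -> U t -> (forall s, U s -> f s = g s) -> derive1 f t = derive1 g t.
Proof.
by move=> oU Ut fg; rewrite !derive1E; apply: near_eq_derive; apply: near_open fg.
Qed.

Lemma eq_ck k U f g :
  open U -> (forall t, U t -> f t = g t) -> ck k U f -> ck k U g.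
Proof.
move=> oU; elim: k f g => [//|k IH] f g fg [df cf]; split.
  move=> t Ut; apply: near_eq_derivable (df t Ut).
  by apply: near_open Ut fg.
by apply: IH cf => t Ut; apply: eq_open_derive1 fg.
Qed.

Lemma ckW k U f : ck k.+1 U f -> ck k U f.
Proof. by elim: k f => [//|k IH] f [df cf]; split=> //; exact: IH. Qed.

Lemma ck_sub k U U' f : U' `<=` U -> ck k U f -> ck k U' f.
Proof.
by move=> sU; elim: k f => [//|k IH] f [df cf]; split=> [t /sU/df//|]; exact: IH.
Qed.

(** The sets [V] need not be open: derivatives are taken in the whole line, so [ck] is a pointwise
    condition on its set. *)
Lemma ck_cover k (U : set R) f :
  (forall t, U t -> exists2 V : set R, V t & ck k V f) -> ck k U f.
Proof.
elim: k f => [//|k IH] f H; split.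
  by move=> t /H [V Vt [df _]]; exact: df.
by apply: IH => t /H [V Vt [_ cf]]; exists V.
Qed.

Lemma ck_cst k U c : ck k U (fun=> c).
Proof.
elim: k c => [//|k IH] c; split=> [t _|]; first exact: derivable_cst.
have -> : derive1 (fun=> c) = (fun=> 0) :> (R -> R); last exact: IH.
by apply/funext => t; rewrite derive1E derive_cst.
Qed.

Lemma ck_id k U : ck k U id.
Proof.
case: k => [//|k]; split=> [t _|]; first exact: derivable_id.
have -> : derive1 id = (fun=> 1) :> (R -> R); last exact: ck_cst.
by apply/funext => t; rewrite derive1E derive_id.
Qed.

Lemma is_derive1D f g (t l m : R) : is_derive t 1 f l -> is_derive t 1 g m ->
  is_derive t 1 (fun s => f s + g s) (l + m).
Proof. exact: is_deriveD. Qed.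

Lemma is_derive1N f (t l : R) : is_derive t 1 f l -> is_derive t 1 (fun s => - f s) (- l).
Proof. exact: is_deriveN. Qed.

Lemma is_derive1M f g (t l m : R) : is_derive t 1 f l -> is_derive t 1 g m ->
  is_derive t 1 (fun s => f s * g s) (l * g t + f t * m).
Proof.
move=> df dg; have := @is_deriveM _ _ _ _ _ _ _ _ df dg.
by rewrite /GRing.scale /= addrC (mulrC (g t)).
Qed.

Lemma derivable_is_derive1 (V : normedModType R) (f : R -> V) (t : R) :
  derivable f t 1 -> is_derive t 1 f (derive1 f t).
Proof. by move=> df; apply/is_derive1P. Qed.

Lemma is_derive1_derivable (V : normedModType R) (f : R -> V) (t : R) (l : V) :
  is_derive t 1 f l -> derivable f t 1.
Proof. by case. Qed.

Lemma is_derive1_eq (V : normedModType R) (f : R -> V) (t : R) (l : V) :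
  is_derive t 1 f l -> derive1 f t = l.
Proof. by case/is_derive1P. Qed.

Lemma ck_is_derive k U f df : open U ->
  (forall t, U t -> is_derive t 1 f (df t)) -> ck k U df -> ck k.+1 U f.
Proof.
move=> oU H cdf; split=> [t /H|]; first exact: is_derive1_derivable.
by apply: eq_ck cdf => // t /H /is_derive1_eq.
Qed.

Lemma ckD k U f g : open U -> ck k U f -> ck k U g -> ck k U (fun t => f t + g t).
Proof.
move=> oU; elim: k f g => [//|k IH] f g [df cf] [dg cg].
apply: (@ck_is_derive _ _ _ (fun t => derive1 f t + derive1 g t)) => //.
  by move=> t Ut; apply: is_derive1D; apply: derivable_is_derive1; auto.
exact: IH.
Qed.

Lemma ckN k U f : open U -> ck k U f -> ck k U (fun t => - f t).
Proof.
move=> oU; elim: k f => [//|k IH] f [df cf].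
apply: (@ck_is_derive _ _ _ (fun t => - derive1 f t)) => //.
  by move=> t Ut; apply: is_derive1N; apply: derivable_is_derive1; auto.
exact: IH.
Qed.

Lemma ckM k U f g : open U -> ck k U f -> ck k U g -> ck k U (fun t => f t * g t).
Proof.
move=> oU; elim: k f g => [//|k IH] f g cf cg; have [df cf'] := cf; have [dg cg'] := cg.
apply: (@ck_is_derive _ _ _ (fun t => derive1 f t * g t + f t * derive1 g t)) => //.
  by move=> t Ut; apply: is_derive1M; apply: derivable_is_derive1; auto.
by apply: ckD => //; apply: IH => //; exact: ckW.
Qed.

Lemma ck_sum k U n (F : 'I_n -> R -> R) : open U ->
  (forall i, ck k U (F i)) -> ck k U (fun t => \sum_i F i t).
Proof.
move=> oU; elim: n F => [|n IH] F H.
  by apply: (eq_ck oU _ (ck_cst k U 0)) => t _; rewrite big_ord0.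
have : ck k U (fun t => \sum_i F (widen_ord (leqnSn n) i) t + F ord_max t).
  by apply: ckD => //; exact: IH.
by apply: eq_ck => // t _; rewrite big_ord_recr.
Qed.

Lemma ckV k U f : open U -> (forall t, U t -> f t != 0) ->
  ck k U f -> ck k U (fun t => (f t)^-1).
Proof.
move=> oU f0; elim: k => [//|k IH] cf; have [df cf'] := cf.
have cV := IH (ckW cf).
apply: (@ck_is_derive _ _ _ (fun t => - (((f t)^-1 * (f t)^-1) * derive1 f t))) => //.
  move=> t Ut; have := is_deriveV (f0 t Ut) (derivable_is_derive1 (df t Ut)).
  by rewrite /GRing.scale /= mulNr expr2 invfM.
by apply: ckN => //; apply: ckM => //; apply: ckM.
Qed.

Lemma ck_sqrt k U f : open U -> (forall t, U t -> 0 < f t) ->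
  ck k U f -> ck k U (fun t => Num.sqrt (f t)).
Proof.
move=> oU f0; elim: k => [//|k IH] cf; have [df cf'] := cf.
have cV := IH (ckW cf).
apply: (@ck_is_derive _ _ _ (fun t => (2 * Num.sqrt (f t))^-1 * derive1 f t)) => //.
  move=> t Ut.
  exact: (is_derive1_comp (is_derive1_sqrt (f0 t Ut)) (derivable_is_derive1 (df t Ut))).
apply: ckM => //; apply: ckV => //.
  by move=> t Ut; rewrite mulf_neq0 // gt_eqF // sqrtr_gt0 f0.
by apply: ckM => //; exact: ck_cst.
Qed.

Lemma ck_continuous k U f t : ck k.+1 U f -> U t -> {for t, continuous f}.
Proof.
by move=> [df _] Ut; apply: differentiable_continuous; apply/derivable1_diffP; exact: df.
Qed.

End ScalarSmoothness.

(** * Smooth matrix functions *)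

Section MatrixSmoothness.
Variable R : realType.
Implicit Types (U : set R) (k m n p : nat).

Definition mck k U m n (M : R -> 'M[R]_(m, n)) :=
  forall i j, ck k U (fun t => M t i j).

(** All orders at once, so that derivatives of coefficients and frames never have to be counted. *)
Definition sm U m n (M : R -> 'M[R]_(m, n)) := forall k, mck k U M.

(** Entrywise, so that the scalar rules apply directly; [derive1_dmx] identifies it with the
    derivative of the statement. *)
Definition dmx m n (M : R -> 'M[R]_(m, n)) (t : R) : 'M[R]_(m, n) :=
  \matrix_(i, j) derive1 (fun s => M s i j) t.

Lemma eq_dmx U m n (M N : R -> 'M[R]_(m, n)) t : open U -> U t ->
  (forall t, U t -> M t = N t) -> dmx M t = dmx N t.
Proof.
move=> oU Ut MN; apply/matrixP => i j; rewrite !mxE.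
by apply: eq_open_derive1 Ut _ => // s /MN ->.
Qed.

Lemma mck_sub k U U' m n (M : R -> 'M[R]_(m, n)) :
  U' `<=` U -> mck k U M -> mck k U' M.
Proof. by move=> sU cM i j; exact: ck_sub (cM i j). Qed.

Lemma mckW k U m n (M : R -> 'M[R]_(m, n)) : mck k.+1 U M -> mck k U M.
Proof. by move=> cM i j; exact: ckW. Qed.

Lemma mck_cst k U m n (A : 'M[R]_(m, n)) : mck k U (fun=> A).
Proof. by move=> i j; exact: ck_cst. Qed.

Lemma mckD k U m n (M N : R -> 'M[R]_(m, n)) : open U ->
  mck k U M -> mck k U N -> mck k U (fun t => M t + N t).
Proof.
move=> oU cM cN i j; apply: eq_ck (ckD oU (cM i j) (cN i j)) => // t _.
by rewrite mxE.
Qed.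

Lemma mckN k U m n (M : R -> 'M[R]_(m, n)) : open U ->
  mck k U M -> mck k U (fun t => - M t).
Proof.
by move=> oU cM i j; apply: eq_ck (ckN oU (cM i j)) => // t _; rewrite mxE.
Qed.

Lemma mckZ k U m n f (M : R -> 'M[R]_(m, n)) : open U ->
  ck k U f -> mck k U M -> mck k U (fun t => f t *: M t).
Proof.
by move=> oU cf cM i j; apply: eq_ck (ckM oU cf (cM i j)) => // t _; rewrite mxE.
Qed.

Lemma mckM k U m n p (M : R -> 'M[R]_(m, n)) (N : R -> 'M[R]_(n, p)) : open U ->
  mck k U M -> mck k U N -> mck k U (fun t => M t *m N t).
Proof.
move=> oU cM cN i j.
apply: (@eq_ck _ _ _ (fun t => \sum_l M t i l * N t l j)) => //.
  by move=> t _; rewrite mxE.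
by apply: ck_sum => // l; apply: ckM.
Qed.

Lemma mckT k U m n (M : R -> 'M[R]_(m, n)) : open U ->
  mck k U M -> mck k U (fun t => (M t)^T).
Proof. by move=> oU cM i j; apply: eq_ck (cM j i) => // t _; rewrite mxE. Qed.

Lemma mck_row k U m n p (M : R -> 'M[R]_(m, n)) (N : R -> 'M[R]_(m, p)) : open U ->
  mck k U M -> mck k U N -> mck k U (fun t => row_mx (M t) (N t)).
Proof.
move=> oU cM cN i j; case: (split_ordP j) => l ->.
  by apply: eq_ck (cM i l) => // t _; rewrite row_mxEl.
by apply: eq_ck (cN i l) => // t _; rewrite row_mxEr.
Qed.

Lemma mck_dmx k U m n (M : R -> 'M[R]_(m, n)) : open U ->
  mck k.+1 U M -> mck k U (dmx M).
Proof.
by move=> oU cM i j; have [_] := cM i j; apply: eq_ck => // t _; rewrite mxE.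
Qed.

Lemma ck_det k U n (M : R -> 'M[R]_n) : open U ->
  mck k U M -> ck k U (fun t => \det (M t)).
Proof.
move=> oU; elim: n M => [|n IH] M cM.
  by apply: eq_ck (ck_cst k U 1) => // t _; rewrite det_mx00.
apply: (@eq_ck _ _ _ (fun t => \sum_j M t ord0 j * cofactor (M t) ord0 j)) => //.
  by move=> t _; rewrite -expand_det_row.
apply: ck_sum => // j; apply: ckM => //; apply: ckM => //; first exact: ck_cst.
by apply: IH => a b; apply: eq_ck (cM (lift ord0 a) (lift j b)) => // t _; rewrite !mxE.
Qed.

Lemma mck_inv k U n (M : R -> 'M[R]_n) : open U ->
  (forall t, U t -> M t \in unitmx) -> mck k U M -> mck k U (fun t => invmx (M t)).
Proof.
move=> oU uM cM i j.
apply: (@eq_ck _ _ _ (fun t => (\det (M t))^-1 * cofactor (M t) j i)) => //.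
  by move=> t Ut; rewrite /invmx uM // !mxE.
apply: ckM => //.
  apply: ckV => //; last exact: ck_det.
  by move=> t /uM; rewrite unitmxE unitfE.
apply: ckM => //; first exact: ck_cst.
by apply: ck_det => // a b; apply: eq_ck (cM (lift j a) (lift i b)) => // t _; rewrite !mxE.
Qed.

Lemma mck1_is_derive U m n (M : R -> 'M[R]_(m, n)) t i j : mck 1 U M -> U t ->
  is_derive t 1 (fun s => M s i j) (dmx M t i j).
Proof.
move=> cM Ut; rewrite mxE; have [dM _] := cM i j.
exact: derivable_is_derive1 (dM t Ut).
Qed.

Lemma dmxD U m n (M N : R -> 'M[R]_(m, n)) t : mck 1 U M -> mck 1 U N -> U t ->
  dmx (fun s => M s + N s) t = dmx M t + dmx N t.
Proof.
move=> cM cN Ut; apply/matrixP => i j; rewrite mxE [RHS]mxE.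
rewrite (_ : (fun s => _) = (fun s => M s i j + N s i j)).
  apply: is_derive1_eq; apply: is_derive1D; exact: mck1_is_derive Ut.
by apply/funext => s; rewrite mxE.
Qed.

Lemma dmxN U m n (M : R -> 'M[R]_(m, n)) t : mck 1 U M -> U t ->
  dmx (fun s => - M s) t = - dmx M t.
Proof.
move=> cM Ut; apply/matrixP => i j; rewrite mxE [RHS]mxE.
rewrite (_ : (fun s => _) = (fun s => - M s i j)).
  apply: is_derive1_eq; apply: is_derive1N; exact: mck1_is_derive Ut.
by apply/funext => s; rewrite mxE.
Qed.

Lemma dmxZ U m n f (M : R -> 'M[R]_(m, n)) t : ck 1 U f -> mck 1 U M -> U t ->
  dmx (fun s => f s *: M s) t = derive1 f t *: M t + f t *: dmx M t.
Proof.
move=> [df _] cM Ut; apply/matrixP => i j; rewrite mxE [RHS]mxE.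
rewrite (_ : (fun s => _) = (fun s => f s * M s i j)).
  apply: is_derive1_eq; rewrite [X in X + _]mxE [X in _ + X]mxE.
  apply: is_derive1M; last exact: mck1_is_derive Ut.
  exact: derivable_is_derive1 (df t Ut).
by apply/funext => s; rewrite mxE.
Qed.

Lemma dmxM U m n p (M : R -> 'M[R]_(m, n)) (N : R -> 'M[R]_(n, p)) t :
  mck 1 U M -> mck 1 U N -> U t ->
  dmx (fun s => M s *m N s) t = dmx M t *m N t + M t *m dmx N t.
Proof.
move=> cM cN Ut; apply/matrixP => i j; rewrite mxE [RHS]mxE.
rewrite [X in _ = X + _]mxE [X in _ = _ + X]mxE -big_split /=.
rewrite (_ : (fun s => _) = \sum_l (fun s => M s i l * N s l j)); last first.
  by apply/funext => s; rewrite mxE fct_sumE.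
rewrite derive1E derive_sum => [|l]; last first.
  by apply: is_derive1_derivable; apply: is_derive1M; exact: mck1_is_derive Ut.
apply: eq_bigr => l _; rewrite -derive1E; apply: is_derive1_eq.
by apply: is_derive1M; exact: mck1_is_derive Ut.
Qed.

Lemma dmxT m n (M : R -> 'M[R]_(m, n)) t : dmx (fun s => (M s)^T) t = (dmx M t)^T.
Proof.
apply/matrixP => i j; rewrite !mxE; congr (derive1 _ t).
by apply/funext => s; rewrite mxE.
Qed.

Lemma dmx_row m n p (M : R -> 'M[R]_(m, n)) (N : R -> 'M[R]_(m, p)) t :
  dmx (fun s => row_mx (M s) (N s)) t = row_mx (dmx M t) (dmx N t).
Proof.
apply/matrixP => i j; case: (split_ordP j) => l ->.
  rewrite row_mxEl !mxE; congr (derive1 _ t); apply/funext => s.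
  by rewrite row_mxEl.
rewrite row_mxEr !mxE; congr (derive1 _ t); apply/funext => s.
by rewrite row_mxEr.
Qed.

Lemma dmx_cst m n (A : 'M[R]_(m, n)) t : dmx (fun=> A) t = 0.
Proof. by apply/matrixP => i j; rewrite !mxE derive1E derive_cst. Qed.

Lemma sm_sub U U' m n (M : R -> 'M[R]_(m, n)) : U' `<=` U -> sm U M -> sm U' M.
Proof. by move=> sU cM k; exact: mck_sub (cM k). Qed.

Lemma sm_cst U m n (A : 'M[R]_(m, n)) : sm U (fun=> A).
Proof. by move=> k; exact: mck_cst. Qed.

Lemma smD U m n (M N : R -> 'M[R]_(m, n)) : open U ->
  sm U M -> sm U N -> sm U (fun t => M t + N t).
Proof. by move=> oU cM cN k; exact: mckD. Qed.

Lemma smN U m n (M : R -> 'M[R]_(m, n)) : open U ->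
  sm U M -> sm U (fun t => - M t).
Proof. by move=> oU cM k; exact: mckN. Qed.

Lemma smM U m n p (M : R -> 'M[R]_(m, n)) (N : R -> 'M[R]_(n, p)) : open U ->
  sm U M -> sm U N -> sm U (fun t => M t *m N t).
Proof. by move=> oU cM cN k; exact: mckM. Qed.

Lemma smT U m n (M : R -> 'M[R]_(m, n)) : open U ->
  sm U M -> sm U (fun t => (M t)^T).
Proof. by move=> oU cM k; exact: mckT. Qed.

Lemma sm_row U m n p (M : R -> 'M[R]_(m, n)) (N : R -> 'M[R]_(m, p)) : open U ->
  sm U M -> sm U N -> sm U (fun t => row_mx (M t) (N t)).
Proof. by move=> oU cM cN k; exact: mck_row. Qed.

Lemma sm_dmx U m n (M : R -> 'M[R]_(m, n)) : open U -> sm U M -> sm U (dmx M).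
Proof. by move=> oU cM k; exact: mck_dmx. Qed.

Lemma sm_inv U n (M : R -> 'M[R]_n) : open U ->
  (forall t, U t -> M t \in unitmx) -> sm U M -> sm U (fun t => invmx (M t)).
Proof. by move=> oU uM cM k; exact: mck_inv. Qed.

Lemma open_preimage_ck1 U f (X : set R) :
  open U -> ck 1 U f -> open X -> open (U `&` f @^-1` X).
Proof.
move=> oU cf; apply: (iffLR (continuous_inP f oU)) => t.
by rewrite inE => Ut; exact: ck_continuous cf Ut.
Qed.

End MatrixSmoothness.

(** * Smooth frames adapted to symmetric, skew and rectangular matrices *)

Section SylvesterFrames.
Variable R : realType.
Implicit Types (U : set R) (m n p q r : nat).

Lemma mul_col'1_row' n (i : 'I_n.+1) m (Y : 'M[R]_(n.+1, m)) :
  (forall j, Y i j = 0) -> col' i 1%:M *m row' i Y = Y.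
Proof.
move=> Y0; apply/matrixP => a b.
rewrite -[in RHS](mul1mx Y) !mxE (bigD1_ord i) //= Y0 mulr0 add0r.
by apply: eq_bigr => k _; rewrite !mxE.
Qed.

(** The vector [v] and the unit vectors other than the i-th form a basis; this is the identity
    resolved in it. *)
Lemma col'_complement n (i : 'I_n.+1) (v : 'cV[R]_n.+1) : v i 0 = 1 ->
  v *m delta_mx 0 i + col' i 1%:M *m row' i (1%:M - v *m delta_mx 0 i) = 1%:M.
Proof.
move=> vi; rewrite mul_col'1_row' ?subrKC // => j.
by rewrite !mxE big_ord1 vi mul1r !mxE eqxx /= eq_sym subrr.
Qed.

Lemma mul_row_gram m n1 n2 p1 p2 (a : 'M[R]_(m, n1)) (b : 'M[R]_(m, n2)) M
    (c : 'M[R]_(m, p1)) (d : 'M[R]_(m, p2)) :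
  (row_mx a b)^T *m M *m row_mx c d =
  block_mx (a^T *m M *m c) (a^T *m M *m d) (b^T *m M *m c) (b^T *m M *m d).
Proof. by rewrite tr_row_mx mul_col_mx mul_col_row. Qed.

(** A nonzero diagonal entry is reached by a unit vector. If the diagonal vanishes, polarisation
    gives the value 2 E_ij at e_i + e_j. The normalisation of the i-th coordinate serves
    [col'_complement]. *)
Lemma sym_pivot n (E : 'M[R]_n.+1) : E^T = E -> E != 0 ->
  exists i (v : 'cV[R]_n.+1), v i 0 = 1 /\ (v^T *m E *m v) 0 0 != 0.
Proof.
move=> sE E0; have q (i j : 'I_n.+1) :
  (delta_mx 0 i : 'rV[R]_n.+1) *m E *m delta_mx j 0 = (E i j)%:M.
  by rewrite -rowE -colE; apply/matrixP => a b; rewrite !mxE !ord1 eqxx.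
have [[i Ei]|Ed] := pselect (exists i, E i i != 0).
  exists i, (delta_mx i 0); rewrite mxE !eqxx; split=> //.
  by rewrite trmx_delta q mxE eqxx.
have {}Ed i : E i i = 0.
  by apply/eqP; apply: contrapT => /negP Ei; apply: Ed; exists i.
have [i [j Eij]] : exists i j, E i j != 0.
  apply: contrapT => H; case/eqP: E0; apply/matrixP => i j; rewrite mxE.
  by apply/eqP; apply: contrapT => /negP Eij; apply: H; exists i, j.
have ij : i != j by apply: contraNneq Eij => ->; rewrite Ed.
exists i, (delta_mx i 0 + delta_mx j 0); split.
  by rewrite !mxE !eqxx (negPf ij) addr0.
have -> : (delta_mx i 0 + delta_mx j 0 : 'cV[R]_n.+1)^T = delta_mx 0 i + delta_mx 0 j.
  by rewrite -(trmx_delta _ i 0) -(trmx_delta _ j 0) -raddfD.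
have Eji : E j i = E i j by rewrite -[in LHS]sE mxE.
rewrite !mulmxDl !mulmxDr !q !Ed Eji !mxE !eqxx /= !mulr1n.
by rewrite add0r addr0 -mulr2n mulrn_eq0.
Qed.

Lemma mx0_eq n (A B : 'M[R]_(0, n)) : A = B.
Proof. by rewrite [A]flatmx0 [B]flatmx0. Qed.

Lemma mxn0_eq n (A B : 'M[R]_(n, 0)) : A = B.
Proof. by rewrite [A]thinmx0 [B]thinmx0. Qed.

(** Spanning is stated as a pointwise resolution of the identity without smoothness of the
    coefficients; together with the dimension count it makes the three frames a basis. *)
Definition sylvester_frames U n (E : R -> 'M[R]_n) p q r
    (F1 : R -> 'M[R]_(n, p)) (F2 : R -> 'M[R]_(n, q)) (V : R -> 'M[R]_(n, r)) :=
  [/\ n = (p + q + r)%N, sm U F1, sm U F2, sm U V & forall t, U t ->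
   [/\ (F1 t)^T *m E t *m F1 t = 1%:M, (F2 t)^T *m E t *m F2 t = - 1%:M,
       (F1 t)^T *m E t *m F2 t = 0, E t *m V t = 0
     & exists G1 G2 G3, F1 t *m G1 + F2 t *m G2 + V t *m G3 = 1%:M]].

(** Lagrange's diagonalisation, one dimension at a time: unless [E] vanishes on all of [U], a
    constant vector that is not isotropic at some point stays so nearby, and the induction continues
    on its [E]-orthogonal complement. *)
Lemma exists_sylvester_frames n U (E : R -> 'M[R]_n) :
  open U -> U !=set0 -> sm U E -> (forall t, U t -> (E t)^T = E t) ->
  exists U', [/\ open U', U' !=set0, U' `<=` U &
   exists p q r (F1 : R -> 'M[R]_(n, p)) (F2 : R -> 'M[R]_(n, q))
     (V : R -> 'M[R]_(n, r)), sylvester_frames U' E F1 F2 V].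
Proof.
elim: n U E => [|n IH] U E oU U0 smE symE.
  exists U; split=> //; exists 0%N, 0%N, 0%N, (fun=> 0), (fun=> 0), (fun=> 0).
  split=> //; try exact: sm_cst.
  by move=> t Ut; split; try exact: mx0_eq; exists 0, 0, 0; exact: mx0_eq.
have [E0|] := pselect (forall t, U t -> E t = 0).
  exists U; split=> //; exists 0%N, 0%N, n.+1, (fun=> 0), (fun=> 0), (fun=> 1%:M).
  split=> //; try exact: sm_cst.
  move=> t Ut; split; try exact: mx0_eq; first by rewrite E0 // mul0mx.
  by exists 0, 0, 1%:M; rewrite !mul0mx !add0r mul1mx.
move=> /existsNP[t0 /not_implyP[Ut0 /eqP Et0]].
have [i [v [vi vEv]]] := sym_pivot (symE _ Ut0) Et0.
pose f t := (v^T *m E t *m v) 0 0.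
have smf k : ck k U f.
  by apply: mckM => //; [apply: mckM => //; exact: mck_cst|exact: mck_cst].
(* The sign is frozen at [t0]; on [U1], where e f > 0, it decides once and for all whether the pivot
   counts for [p] or for [q]. *)
pose e : R := Num.sg (f t0).
have e2 : e * e = 1 by rewrite -expr2 sqr_sg vEv.
have e1 : e = 1 \/ e = -1.
  rewrite /e; case: (ltgtP (f t0) 0) => [/ltr0_sg|/gtr0_sg|f0]; [by right|by left|].
  by case/eqP: vEv.
have eV : e^-1 = e by case: e1 => ->; rewrite ?invrN invr1.
have ef0 : 0 < e * f t0 by rewrite -normrEsg normr_gt0.
have smef k : ck k U (fun t => e * f t) by apply: ckM => //; exact: ck_cst.
pose U1 := U `&` (fun t => e * f t) @^-1` [set x | 0 < x].
have oU1 : open U1 by apply: open_preimage_ck1 => //; exact: open_gt.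
have U10 : U1 !=set0 by exists t0.
have U1U : U1 `<=` U by move=> t [].
pose a t := Num.sqrt (e * f t).
have a0 t : U1 t -> a t != 0 by case=> _ h; rewrite gt_eqF // sqrtr_gt0.
have a2 t : U1 t -> a t * a t = e * f t by case=> _ h; rewrite -expr2 sqr_sqrtr // ltW.
have f0 t : U1 t -> f t != 0.
  by case=> _ h; apply: contraTneq h => /= ->; rewrite mulr0 ltxx.
have sma k : ck k U1 (fun t => (a t)^-1).
  apply: ckV => //; apply: ck_sqrt => // [t [] //|].
  exact: ck_sub (smef k).
pose u t : 'cV[R]_n.+1 := (a t)^-1 *: v.
have smu : sm U1 u by move=> k; apply: mckZ => //; exact: mck_cst.
pose C : 'M[R]_(n.+1, n) := col' i 1%:M.
(* Gram-Schmidt coefficients: subtracting v L from the remaining unit vectors makes them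
   [E]-orthogonal to [v]. *)
pose L t : 'rV[R]_n := (f t)^-1 *: (v^T *m E t *m C).
have smE1 : sm U1 E by exact: sm_sub smE.
have smL : sm U1 L.
  move=> k; apply: mckZ => //.
    by apply: ckV => //; exact: ck_sub (smf k).
  by apply: mckM => //; [apply: mckM => //; exact: mck_cst|exact: mck_cst].
pose N t : 'M[R]_(n.+1, n) := C - v *m L t.
have smN' : sm U1 N.
  apply: smD => //; first exact: sm_cst.
  by apply: smN => //; apply: smM => //; exact: sm_cst.
have vEvE t : v^T *m E t *m v = (f t)%:M by exact: mx11_scalar.
have vEN t : U1 t -> v^T *m E t *m N t = 0.
  move=> Ut; rewrite mulmxBr mulmxA vEvE mul_scalar_mx scalerA mulfV ?f0 //.
  by rewrite scale1r subrr.
have uT t : (u t)^T = (a t)^-1 *: v^T by rewrite /u linearZ.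
have uEN t : U1 t -> (u t)^T *m E t *m N t = 0.
  by move=> Ut; rewrite uT -!scalemxAl vEN // scaler0.
have uEu t : U1 t -> (u t)^T *m E t *m u t = e%:M.
  move=> Ut; rewrite uT -!scalemxAl -scalemxAr vEvE scalerA -invfM a2 //.
  by rewrite scale_scalar_mx invfM mulfVK ?f0 // eV.
have spanuN t : U1 t -> exists g1 g2, u t *m g1 + N t *m g2 = 1%:M.
  move=> Ut; pose D := row' i (1%:M - v *m delta_mx 0 i).
  (* Since a u = v, the two contributions v L D cancel and [col'_complement] remains. *)
  exists (a t *: (delta_mx 0 i + L t *m D)), D.
  rewrite -scalemxAl -scalemxAr scalerA mulVf ?a0 // scale1r mulmxBl mulmxDr.
  by rewrite -[RHS](col'_complement vi) mulmxA -addrA subrKC.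
pose E' t := (N t)^T *m E t *m N t.
have smE' : sm U1 E' by apply: smM => //; apply: smM => //; exact: smT.
have symE' t : U1 t -> (E' t)^T = E' t.
  by move=> [Ut _]; rewrite !trmx_mul trmxK symE // mulmxA.
have [U2 [oU2 U20 U21 [p [q [r [F1 [F2 [V [enpq sF1 sF2 sV H]]]]]]]]] :=
  IH U1 E' oU1 U10 smE' symE'.
have smN2 := sm_sub U21 smN'; have smu2 := sm_sub U21 smu.
have NEu t : U2 t -> (N t)^T *m E t *m u t = 0.
  move=> /U21 U1t; apply: trmx_inj; rewrite trmx0 !trmx_mul trmxK symE ?mulmxA; last exact: U1U.
  exact: uEN.
have NE m1 m2 t (X : 'M[R]_(n, m1)) (Y : 'M[R]_(n, m2)) :
  (N t *m X)^T *m E t *m (N t *m Y) = X^T *m E' t *m Y.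
  by rewrite trmx_mul !mulmxA.
have uN m1 t (X : 'M[R]_(n, m1)) : U2 t -> (u t)^T *m E t *m (N t *m X) = 0.
  by move=> /U21 U1t; rewrite mulmxA uEN // mul0mx.
have Nu m1 t (X : 'M[R]_(n, m1)) : U2 t -> (N t *m X)^T *m E t *m u t = 0.
  by move=> Ut; rewrite trmx_mul -!mulmxA [_ *m (_ *m u t)]mulmxA NEu // mulmx0.
have EV t : U2 t -> E t *m (N t *m V t) = 0.
  move=> Ut; have [_ _ _ EV _] := H t Ut; have U1t := U21 _ Ut.
  have [g1 [g2 g]] := spanuN t U1t.
  (* E N V is tested against the basis u, N: the first test vanishes by orthogonality, the second
     because [V] is in the kernel of the compressed matrix [E']. *)
  have : (u t *m g1 + N t *m g2)^T *m E t *m (N t *m V t) = 0.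
    rewrite raddfD /= !trmx_mul (mulmxDl (g1^T *m (u t)^T)) (mulmxDl (g1^T *m (u t)^T *m E t)).
    have -> : g1^T *m (u t)^T *m E t *m (N t *m V t)
      = g1^T *m ((u t)^T *m E t *m (N t *m V t)) by rewrite !mulmxA.
    have -> : g2^T *m (N t)^T *m E t *m (N t *m V t) = g2^T *m (E' t *m V t).
      by rewrite !mulmxA.
    by rewrite uN // EV !mulmx0 addr0.
  by rewrite g trmx1 mul1mx.
exists U2; split=> //; first by move=> t /U21/U1U.
case: e1 => e1.
- exists (1 + p)%N, q, r, (fun t => row_mx (u t) (N t *m F1 t)), (fun t => N t *m F2 t),
    (fun t => N t *m V t).
  split.
  + by rewrite enpq.
  + by apply: sm_row => //; exact: smM.
  + exact: smM.
  + exact: smM.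
  move=> t Ut; have [H1 H2 H3 H4 [G1 [G2 [G3 HG]]]] := H t Ut; have U1t := U21 _ Ut.
  split.
  + by rewrite mul_row_gram uEu // uN // Nu // NE H1 e1 -scalar_mx_block.
  + by rewrite NE.
  + by rewrite tr_row_mx !mul_col_mx uN // NE H3 col_mx0.
  + exact: EV.
  have [g1 [g2 g]] := spanuN t U1t.
  exists (col_mx g1 (G1 *m g2)), (G2 *m g2), (G3 *m g2).
  rewrite mul_row_col !mulmxA -!addrA -!mulmxDl -[RHS]g; congr (_ + _).
  by rewrite -[in RHS](mulmx1 (N t)) -HG !mulmxDr !mulmxA !addrA.
- exists p, (1 + q)%N, r, (fun t => N t *m F1 t), (fun t => row_mx (u t) (N t *m F2 t)),
    (fun t => N t *m V t).
  split.
  + by rewrite enpq add1n addnS addSn.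
  + exact: smM.
  + by apply: sm_row => //; exact: smM.
  + exact: smM.
  move=> t Ut; have [H1 H2 H3 H4 [G1 [G2 [G3 HG]]]] := H t Ut; have U1t := U21 _ Ut.
  split.
  + by rewrite NE.
  + rewrite mul_row_gram uEu // uN // Nu // NE H2 e1 scalar_mx_block.
    by rewrite opp_block_mx !oppr0 raddfN.
  + by rewrite mul_mx_row Nu // NE H3 row_mx0.
  + exact: EV.
  have [g1 [g2 g]] := spanuN t U1t.
  exists (G1 *m g2), (col_mx g1 (G2 *m g2)), (G3 *m g2).
  rewrite mul_row_col !mulmxA addrCA -!addrA -!mulmxDl -[RHS]g; congr (_ + _).
  by rewrite -[in RHS](mulmx1 (N t)) -HG !mulmxDr !mulmxA !addrA.
Qed.

End SylvesterFrames.

(** * Frames for skew and rectangular matrix functions, through Gram matrices *)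

Section FrameConsequences.
Variable R : realType.
Implicit Types (U : set R) (m n p q r k s : nat).

Definition signature_mx p q : 'M[R]_(p + q) := block_mx 1%:M 0 0 (- 1%:M).

Lemma signature_mxK p q : signature_mx p q *m signature_mx p q = 1%:M.
Proof.
rewrite /signature_mx mulmx_block !mul0mx !mulmx0 !addr0 add0r mulmx1 mulmxN mulmx1.
by rewrite opprK -scalar_mx_block.
Qed.

Lemma exists_signature_frame n U (E : R -> 'M[R]_n) :
  open U -> U !=set0 -> sm U E -> (forall t, U t -> (E t)^T = E t) ->
  exists U' p q r (F : R -> 'M[R]_(n, p + q)) (V : R -> 'M[R]_(n, r)),
   [/\ open U', U' !=set0, U' `<=` U, n = (p + q + r)%N & [/\ sm U' F, sm U' V &
   forall t, U' t ->
     [/\ (F t)^T *m E t *m F t = signature_mx p q, E t *m V t = 0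
       & exists G1 G2, F t *m G1 + V t *m G2 = 1%:M]]].
Proof.
move=> oU U0 smE symE.
have [U' [oU' U'0 sU [p [q [r [F1 [F2 [V [enpq s1 s2 sV H]]]]]]]]] :=
  exists_sylvester_frames oU U0 smE symE.
exists U', p, q, r, (fun t => row_mx (F1 t) (F2 t)), V; split=> //; split=> //.
  exact: sm_row.
move=> t Ut; have [H1 H2 H3 H4 [G1 [G2 [G3 HG]]]] := H t Ut; split=> //.
  rewrite mul_row_gram H1 H2 H3 /signature_mx; congr block_mx.
  by apply: trmx_inj; rewrite trmx0 !trmx_mul trmxK symE ?mulmxA ?H3 //; exact: sU.
by exists (col_mx G1 G2), G3; rewrite mul_row_col.
Qed.

(** The diagonal entries of the Gram matrix are sums of squares of the columns. *)
Lemma gram_eq0 m n (A : 'M[R]_(m, n)) : A^T *m A = 0 -> A = 0.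
Proof.
move=> AA; apply/matrixP => i j; rewrite mxE; apply/eqP; rewrite -sqrf_eq0.
have /eqP : (A^T *m A) j j = 0 by rewrite AA mxE.
rewrite mxE psumr_eq0 => [/allP/(_ i)|l _]; rewrite mxE -expr2; last exact: sqr_ge0.
by rewrite mem_index_enum => /(_ isT).
Qed.

Lemma gram_ker m n p (A : 'M[R]_(m, n)) (V : 'M[R]_(n, p)) :
  A^T *m A *m V = 0 -> A *m V = 0.
Proof. by move=> AV; apply: gram_eq0; rewrite trmx_mul -!mulmxA [A^T *m _]mulmxA AV mulmx0. Qed.

Lemma square_mulmx1C m n (Q : 'M[R]_(m, n)) (G : 'M[R]_(n, m)) :
  m = n -> Q *m G = 1%:M -> G *m Q = 1%:M.
Proof. by move=> emn; case: n / emn Q G => Q G /mulmx1C. Qed.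

Lemma inverses_square m n (Q : 'M[R]_(m, n)) (G X : 'M[R]_(n, m)) :
  Q *m G = 1%:M -> X *m Q = 1%:M -> m = n.
Proof. by move=> /mulmx1_min mn /mulmx1_min nm; apply/eqP; rewrite eqn_leq mn. Qed.

(** The frame of the symmetric M^T M works: its kernel part is the kernel of M. By skewness V^T M =
    0, hence M F = G1^T (F^T M F), and the invertible F^T M^T M F has F^T M F as a right factor. *)
Lemma exists_skew_frame r U (M : R -> 'M[R]_r) :
  open U -> U !=set0 -> sm U M -> (forall t, U t -> (M t)^T = - M t) ->
  exists U' s k (F : R -> 'M[R]_(r, s)) (V : R -> 'M[R]_(r, k)),
   [/\ open U', U' !=set0, U' `<=` U, r = (s + k)%N & [/\ sm U' F, sm U' V &
   forall t, U' t ->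
     [/\ (F t)^T *m M t *m F t \in unitmx, M t *m V t = 0
       & exists G1 G2, F t *m G1 + V t *m G2 = 1%:M]]].
Proof.
move=> oU U0 hM skM; pose E t : 'M[R]_r := (M t)^T *m M t.
have smE : sm U E by apply: smM => //; exact: smT.
have symE t : U t -> (E t)^T = E t by rewrite trmx_mul trmxK.
have [U' [p [q [k [F [V [oU' U'0 sU er [sF sV H]]]]]]]] :=
  exists_signature_frame oU U0 smE symE.
exists U', (p + q)%N, k, F, V; split=> //; split=> // t Ut.
have [HF /gram_ker HV [G1 [G2 HG]]] := H t Ut; split=> //; last by exists G1, G2.
have MF : M t *m F t = G1^T *m ((F t)^T *m M t *m F t).
  have VM : (V t)^T *m M t = 0.
    by apply: trmx_inj; rewrite trmx_mul trmxK skM ?mulNmx ?HV ?oppr0 ?trmx0 //; exact: sU.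
  rewrite -[in LHS](mul1mx (M t)) -trmx1 -HG raddfD /= !trmx_mul !mulmxDl.
  by rewrite -[G2^T *m _ *m _]mulmxA VM mulmx0 mul0mx addr0 !mulmxA.
have : (signature_mx p q *m ((F t)^T *m (M t)^T *m G1^T)) *m ((F t)^T *m M t *m F t) = 1%:M.
  rewrite -mulmxA -[_ *m G1^T *m _]mulmxA -MF -HF -[RHS](signature_mxK p q) -HF.
  by rewrite /E !mulmxA.
by move/mulmx1_unit => [].
Qed.

(** A frame of M^T M decides the alternative. If its kernel part has a column, that column is a
    nowhere vanishing kernel field; otherwise M^T M is invertible, and M has a smooth left inverse
    and a smooth complement. *)
Lemma kernel_field_or_section m k U (M : R -> 'M[R]_(m, k)) :
  open U -> U !=set0 -> sm U M ->
  exists U', [/\ open U', U' !=set0, U' `<=` U &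
    (exists2 v : R -> 'cV[R]_k, sm U' v &
       forall t, U' t -> v t != 0 /\ M t *m v t = 0) \/
    (exists d (C : R -> 'M[R]_(m, k)) (D : R -> 'M[R]_(m, d)),
     [/\ m = (k + d)%N, sm U' C, sm U' D & forall t, U' t ->
       [/\ (C t)^T *m M t = 1%:M, (D t)^T *m M t = 0
         & exists G1 G2, C t *m G1 + D t *m G2 = 1%:M]])].
Proof.
move=> oU U0 hM; pose E t : 'M[R]_k := (M t)^T *m M t.
have smE : sm U E by apply: smM => //; exact: smT.
have symE t : (E t)^T = E t by rewrite trmx_mul trmxK.
have [U1 [p [q [r [F [V [oU1 U10 sU1 er [sF sV H]]]]]]]] :=
  exists_signature_frame oU U0 smE (fun t _ => symE t).
case: r V er sV H => [|r] V er sV H; last first.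
  exists U1; split=> //; left; exists (fun t => V t *m delta_mx 0 0).
    by apply: smM => //; exact: sm_cst.
  move=> t Ut; have [HF /gram_ker HV [G1 [G2 HG]]] := H t Ut.
  split; last by rewrite mulmxA HV mul0mx.
  apply/eqP => V0; have : row_mx (F t) (V t) *m col_mx G1 G2 = 1%:M.
    by rewrite mul_row_col.
  move=> /(square_mulmx1C er); rewrite mul_col_row scalar_mx_block.
  move=> /eq_block_mx[_ _ _ GV]; have : G2 *m (V t *m (delta_mx 0 0 : 'cV[R]_r.+1)) = 0 by rewrite V0 mulmx0.
  rewrite mulmxA GV mul1mx => /matrixP/(_ 0 0); rewrite !mxE eqxx => /eqP.
  by rewrite oner_eq0.
have uE t : U1 t -> E t \in unitmx.
  move=> Ut; have [HF HV [G1 [G2 HG]]] := H t Ut.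
  rewrite [V t]thinmx0 mul0mx addr0 in HG.
  have : E t *m (F t *m signature_mx p q *m (F t)^T) = 1%:M.
    have EF : E t *m F t = G1^T *m signature_mx p q.
      by rewrite -HF !mulmxA -trmx_mul HG trmx1 mul1mx.
    rewrite !mulmxA EF -[_ *m _ *m signature_mx p q]mulmxA signature_mxK mulmx1.
    by rewrite -trmx_mul HG trmx1.
  by move/mulmx1_unit => [].
have hM1 := sm_sub sU1 hM; have smE1 := sm_sub sU1 smE.
(* The transpose of the Moore-Penrose inverse of [M]. *)
pose C t : 'M[R]_(m, k) := M t *m invmx (E t).
have smC : sm U1 C by apply: smM => //; exact: sm_inv.
have MC t : U1 t -> (M t)^T *m C t = 1%:M by move=> Ut; rewrite mulmxA mulmxV // uE.
have CM t : U1 t -> (C t)^T *m M t = 1%:M.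
  by move=> Ut; apply: trmx_inj; rewrite trmx_mul trmxK MC // trmx1.
(* [P t] is the orthogonal projection onto the kernel of [(M t)^T]; a signature
   frame of [P] spans that kernel. *)
pose P t : 'M[R]_m := 1%:M - C t *m (M t)^T.
have smP : sm U1 P.
  apply: smD => //; first exact: sm_cst.
  by apply: smN => //; apply: smM => //; exact: smT.
have symP t : (P t)^T = P t.
  by rewrite raddfB /= trmx1 !trmx_mul trmxK trmx_inv symE mulmxA.
have MP t : U1 t -> (M t)^T *m P t = 0.
  by move=> Ut; rewrite mulmxBr mulmx1 mulmxA MC // mul1mx subrr.
have PM t : U1 t -> P t *m M t = 0.
  by move=> Ut; apply: trmx_inj; rewrite trmx_mul symP MP // trmx0.
have PP t : U1 t -> P t *m P t = P t.
  by move=> Ut; rewrite {1}/P mulmxBl mul1mx -mulmxA MP // mulmx0 subr0.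
have [U2 [p' [q' [r' [F' [V' [oU2 U20 sU2 er' [sF' sV' H']]]]]]]] :=
  exists_signature_frame oU1 U10 smP (fun t _ => symP t).
(* [F'] itself need not lie in the kernel of M^T. Projecting it keeps its Gram matrix with respect
   to [P], and the span survives because P kills [V']. *)
pose D t : 'M[R]_(m, p' + q') := P t *m F' t.
have smD' : sm U2 D by apply: smM => //; exact: sm_sub smP.
have DM t : U2 t -> (D t)^T *m M t = 0.
  by move=> /sU2 Ut; rewrite trmx_mul symP -mulmxA PM // mulmx0.
have span t : U2 t -> exists G1 G2, C t *m G1 + D t *m G2 = 1%:M.
  move=> Ut; have [HF HV [G1 [G2 HG]]] := H' t Ut.
  exists (M t)^T, G1; rewrite -[D t *m G1]addr0 -(mul0mx _ G2) -HV /D -!mulmxA.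
  by rewrite -mulmxDr HG mulmx1 mulmxA subrKC.
exists U2; split=> //; first exact: subset_trans sU1.
right; exists (p' + q')%N, C, D; split=> //.
- have [t Ut] := U20; have [G1 [G2 HG]] := span t Ut.
  (* The Gram matrix of the columns C, D is block diagonal with blocks E^-1 and the signature
     matrix; its inverse times the transposed frame is a left inverse, which forces m = k + d. *)
  rewrite -mul_row_col in HG; apply: (@inverses_square _ _ _ _
    (block_mx (E t) 0 0 (signature_mx p' q') *m (row_mx (C t) (D t))^T) HG).
  have Ut1 := sU2 _ Ut; have [HF _ _] := H' t Ut.
  have CD : (C t)^T *m D t = 0.
    by rewrite trmx_mul -!mulmxA [(M t)^T *m _]mulmxA MP // mul0mx mulmx0.
  have DC : (D t)^T *m C t = 0.
    by apply: trmx_inj; rewrite trmx_mul trmxK CD trmx0.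
  have CC : (C t)^T *m C t = invmx (E t) by rewrite mulmxA CM // mul1mx.
  have DD : (D t)^T *m D t = signature_mx p' q'.
    by rewrite -HF trmx_mul symP -!mulmxA [P t *m (P t *m _)]mulmxA PP.
  rewrite -mulmxA tr_row_mx mul_col_row CC CD DC DD mulmx_block.
  by rewrite !mul0mx !mulmx0 !addr0 add0r signature_mxK mulmxV ?uE // -scalar_mx_block.
- exact: sm_sub smC.
by move=> t Ut; split; [exact/CM/sU2|exact: DM|exact: span].
Qed.

End FrameConsequences.

(** * Bump functions *)

Section Bump.
Variable R : realType.

Lemma is_derive_id1 (s : R) : is_derive s 1 (fun x : R => x) 1.
Proof. exact: is_derive_id. Qed.

Lemma is_derive_sqr_abs (s : R) : is_derive s 1 (fun x : R => x * `|x|) (2 * `|s|).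
Proof.
have main (e : R) (U : set R) : open U -> U s -> (forall x, U x -> `|x| = e * x) ->
    is_derive s 1 (fun x : R => x * `|x|) (2 * `|s|).
  move=> oU Us abs; apply: (@eq_open_is_derive _ _ (fun x => e * (x * x)) _ U) => //.
    by move=> x Ux; rewrite abs // mulrCA.
  have := is_derive1M (is_derive_cst e s 1) (is_derive1M (is_derive_id1 s) (is_derive_id1 s)).
  move=> h; apply: (is_derive_eq h); rewrite mul0r add0r mul1r mulr1 abs //.
  by rewrite /cst; ring.
have [s0|s0|->] := ltgtP s 0.
- apply: (main (-1) [set x | x < 0]) => // x /= x0.
  by rewrite ltr0_norm // mulN1r.
- apply: (main 1 [set x | 0 < x]) => // x /= x0.
  by rewrite gtr0_norm // mul1r.
rewrite normr0 mulr0.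
(* The difference quotient at 0, in the unsimplified shape given by the definition of the
   derivative; it equals |h|. *)
pose q (h : R) : R := h^-1 * ((h * 1 + 0) * `|h * 1 + 0| - 0 * `|0 : R|).
have lim0 : q @ (0 : R)^' --> (0 : R).
  have -> : q = (fun h => `|h|).
    apply/funext => h; rewrite /q addr0 mul0r subr0 mulr1.
    by have [->|h0] := eqVneq h 0; [rewrite mul0r mulr0 normr0|rewrite mulKf].
  rewrite -[X in _ --> X](normr0 R).
  by apply: cvg_within_filter; exact: norm_continuous.
by split; [apply/cvg_ex; exists 0|exact: cvg_lim lim0].
Qed.

Lemma is_derive_exp_abs m (s : R) :
  is_derive s 1 (fun x : R => x ^+ m.+1 * `|x|) (m.+2%:R * (s ^+ m * `|s|)).
Proof.
elim: m => [|m IH].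
  have := is_derive_sqr_abs s.
  by rewrite mul1r; congr is_derive; apply/funext.
have := is_derive1M (is_derive_id1 s) IH.
rewrite (_ : (fun x : R => x * _) = (fun x => x ^+ m.+2 * `|x|)); last first.
  by apply/funext => x; rewrite mulrA -exprS.
move=> h; apply: (is_derive_eq h); rewrite mul1r mulrCA [s * _]mulrA -exprS -[X in X + _]mul1r -mulrDl.
by rewrite -[1]/(1%:R) -natrD add1n.
Qed.

Lemma ck_exp_abs m : ck m setT (fun s : R => s ^+ m * `|s|).
Proof.
elim: m => [//|m IH]; apply: ck_is_derive (fun s _ => is_derive_exp_abs m s) _.
  exact: openT.
by apply: ckM => //; [exact: openT|exact: ck_cst].
Qed.

Lemma ck_exp k m : ck k setT (fun s : R => s ^+ m).
Proof.
elim: m => [|m IH]; first exact: ck_cst.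
rewrite (_ : (fun s => _) = (fun s => s * s ^+ m)); last first.
  by apply/funext => s; rewrite exprS.
by apply: ckM => //; [exact: openT|exact: ck_id].
Qed.

Lemma ck_comp_affine k (f : R -> R) a b :
  ck k setT f -> ck k setT (fun t => f (a * t + b)).
Proof.
elim: k f => [//|k IH] f [df cf].
apply: (@ck_is_derive _ _ _ _ (fun t => derive1 f (a * t + b) * a)); first exact: openT.
  move=> t _; apply: (@is_derive1_comp _ f (fun t => a * t + b)).
    by apply: derivable_is_derive1; exact: df.
  have := is_derive1D (is_derive1M (is_derive_cst a t 1) (is_derive_id1 t))
    (is_derive_cst b t 1).
  by move=> h; apply: (is_derive_eq h); rewrite mul0r add0r mulr1 addr0.
apply: ckM; [exact: openT|exact: IH|exact: ck_cst].
Qed.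

Lemma exists_bump m (c d : R) : c < d -> exists phi : R -> R,
  [/\ ck m setT phi, forall t, ~~ (c <= t <= d) -> phi t = 0
    & exists2 t, c < t < d & phi t != 0].
Proof.
move=> cd; pose P (s : R) := s ^+ m * s + s ^+ m * `|s|.
have cP : ck m setT P.
  apply: ckD (ck_exp_abs m); first exact: openT.
  by apply: ckM; [exact: openT|exact: ck_exp|exact: ck_id].
have P0 s : s <= 0 -> P s = 0.
  by move=> s0; rewrite /P ler0_norm // mulrN subrr.
have P1 s : 0 < s -> P s != 0.
  by move=> s0; rewrite /P gtr0_norm // gt_eqF // addr_gt0 // mulr_gt0 // exprn_gt0.
exists (fun t => P (1 * t + - c) * P (-1 * t + d)); split.
- by apply: ckM; [exact: openT|exact: ck_comp_affine|exact: ck_comp_affine].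
- move=> t; rewrite negb_and -!ltNge mul1r mulN1r => /orP[h|h].
    by rewrite P0 ?mul0r // subr_le0 ltW.
  by rewrite (P0 (_ + d)) ?mulr0 // addrC subr_le0 ltW.
exists ((c + d) / 2); first by rewrite midf_lt // midf_lt.
rewrite mulf_neq0 // P1 // ?mul1r ?mulN1r ?subr_gt0 ?midf_lt //.
by rewrite addrC subr_gt0 midf_lt.
Qed.

End Bump.

(** * Congruence of pairs and reduced systems *)

Section CongruenceForms.
Variable R : realType.
Implicit Types (U : set R) (n m k : nat).

(** For two groups of columns [X], [Y] of Q, [eF] and [aF] are the corresponding blocks of Q^T E Q
    and Q^T A Q - Q^T E Q'. Only [aF] depends on the derivative of its second argument, so
    multiplying [Y] on the right by a function adds an [eF] term. *)
Definition eF n (E : R -> 'M[R]_n) d1 d2 (X : R -> 'M[R]_(n, d1))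
    (Y : R -> 'M[R]_(n, d2)) t : 'M[R]_(d1, d2) := (X t)^T *m E t *m Y t.

Definition aF n (E A : R -> 'M[R]_n) d1 d2 (X : R -> 'M[R]_(n, d1))
    (Y : R -> 'M[R]_(n, d2)) t : 'M[R]_(d1, d2) :=
  (X t)^T *m A t *m Y t - (X t)^T *m E t *m dmx Y t.

Definition skew_on U n (E A : R -> 'M[R]_n) :=
  forall t, U t -> (E t)^T = E t /\ (A t)^T = - A t - dmx E t.

Lemma skew_on_sub U U' n (E A : R -> 'M[R]_n) :
  U' `<=` U -> skew_on U E A -> skew_on U' E A.
Proof. by move=> sU sk t /sU /sk. Qed.

Section Calculus.
Variables (U : set R) (n : nat) (E A : R -> 'M[R]_n).
Hypotheses (oU : open U) (sE : sm U E) (sA : sm U A) (sk : skew_on U E A).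

Lemma sm_eF d1 d2 (X : R -> 'M[R]_(n, d1)) (Y : R -> 'M[R]_(n, d2)) :
  sm U X -> sm U Y -> sm U (eF E X Y).
Proof. by move=> sX sY; apply: smM => //; apply: smM => //; exact: smT. Qed.

Lemma sm_aF d1 d2 (X : R -> 'M[R]_(n, d1)) (Y : R -> 'M[R]_(n, d2)) :
  sm U X -> sm U Y -> sm U (aF E A X Y).
Proof.
move=> sX sY; apply: smD => //; first by apply: smM => //; apply: smM => //; exact: smT.
apply: smN => //; apply: smM => //; last exact: sm_dmx.
by apply: smM => //; exact: smT.
Qed.

Lemma tr_eF d1 d2 (X : R -> 'M[R]_(n, d1)) (Y : R -> 'M[R]_(n, d2)) t :
  U t -> (eF E X Y t)^T = eF E Y X t.
Proof. by move=> /sk[ET _]; rewrite /eF !trmx_mul trmxK ET mulmxA. Qed.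

(** Skew-adjointness survives time-dependent congruence: of the three product-rule terms of (Y^T E
    X)', one comes from E', and the other two account for the derivative terms in [aF]. *)
Lemma tr_aF d1 d2 (X : R -> 'M[R]_(n, d1)) (Y : R -> 'M[R]_(n, d2)) t :
  sm U X -> sm U Y -> U t ->
  (aF E A X Y t)^T = - aF E A Y X t - dmx (eF E Y X) t.
Proof.
move=> sX sY Ut; have [ET AT] := sk Ut.
rewrite /eF (dmxM (U := U)) //; last by apply: mckM => //; exact: mckT.
rewrite (dmxM (U := U)) //; last exact: mckT.
rewrite dmxT /aF raddfB /= !trmx_mul !trmxK AT ET.
rewrite mulmxBl mulmxBr mulNmx mulmxN !mulmxDl !mulmxA.
set a := _ *m A t *m _; set b := _ *m dmx E t *m _; set c := _ *m E t *m X t.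
set e := _ *m dmx X t.
rewrite opprB !opprD [e - a]addrC -!addrA; congr (_ + _).
by rewrite [RHS]addrC -!addrA addNr addr0 addrC.
Qed.

Lemma aF_mul d1 d2 e1 e2 (X : R -> 'M[R]_(n, d1)) (Y : R -> 'M[R]_(n, d2))
    (C : R -> 'M[R]_(d1, e1)) (D : R -> 'M[R]_(d2, e2)) t :
  sm U Y -> sm U D -> U t ->
  aF E A (fun s => X s *m C s) (fun s => Y s *m D s) t =
  (C t)^T *m aF E A X Y t *m D t - (C t)^T *m eF E X Y t *m dmx D t.
Proof.
move=> sY sD Ut; rewrite /aF /eF (dmxM (U := U)) // !trmx_mul.
by rewrite mulmxDr mulmxBr mulmxBl !mulmxA opprD addrA.
Qed.

Lemma aF_mull d1 d2 e1 (X : R -> 'M[R]_(n, d1)) (Y : R -> 'M[R]_(n, d2))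
    (C : R -> 'M[R]_(d1, e1)) t :
  aF E A (fun s => X s *m C s) Y t = (C t)^T *m aF E A X Y t.
Proof. by rewrite /aF trmx_mul mulmxBr !mulmxA. Qed.

Lemma aF_mulr d1 d2 e2 (X : R -> 'M[R]_(n, d1)) (Y : R -> 'M[R]_(n, d2))
    (D : R -> 'M[R]_(d2, e2)) t :
  sm U Y -> sm U D -> U t ->
  aF E A X (fun s => Y s *m D s) t = aF E A X Y t *m D t - eF E X Y t *m dmx D t.
Proof.
move=> sY sD Ut; rewrite /aF /eF (dmxM (U := U)) //.
by rewrite mulmxDr mulmxBl !mulmxA opprD addrA.
Qed.

Lemma eF_row d1 d2 e1 e2 (X1 : R -> 'M[R]_(n, d1)) (X2 : R -> 'M[R]_(n, d2))
    (Y1 : R -> 'M[R]_(n, e1)) (Y2 : R -> 'M[R]_(n, e2)) t :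
  eF E (fun s => row_mx (X1 s) (X2 s)) (fun s => row_mx (Y1 s) (Y2 s)) t =
  block_mx (eF E X1 Y1 t) (eF E X1 Y2 t) (eF E X2 Y1 t) (eF E X2 Y2 t).
Proof. exact: mul_row_gram. Qed.

Lemma aF_row d1 d2 e1 e2 (X1 : R -> 'M[R]_(n, d1)) (X2 : R -> 'M[R]_(n, d2))
    (Y1 : R -> 'M[R]_(n, e1)) (Y2 : R -> 'M[R]_(n, e2)) t :
  aF E A (fun s => row_mx (X1 s) (X2 s)) (fun s => row_mx (Y1 s) (Y2 s)) t =
  block_mx (aF E A X1 Y1 t) (aF E A X1 Y2 t) (aF E A X2 Y1 t) (aF E A X2 Y2 t).
Proof.
by rewrite /aF dmx_row !mul_row_gram opp_block_mx add_block_mx.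
Qed.

Lemma eF_rowr d e1 e2 (X : R -> 'M[R]_(n, d))
    (Y1 : R -> 'M[R]_(n, e1)) (Y2 : R -> 'M[R]_(n, e2)) t :
  eF E X (fun s => row_mx (Y1 s) (Y2 s)) t = row_mx (eF E X Y1 t) (eF E X Y2 t).
Proof. by rewrite /eF mul_mx_row. Qed.

Lemma aF_rowr d e1 e2 (X : R -> 'M[R]_(n, d))
    (Y1 : R -> 'M[R]_(n, e1)) (Y2 : R -> 'M[R]_(n, e2)) t :
  aF E A X (fun s => row_mx (Y1 s) (Y2 s)) t = row_mx (aF E A X Y1 t) (aF E A X Y2 t).
Proof. by rewrite /aF dmx_row !mul_mx_row opp_row_mx add_row_mx. Qed.

Lemma skew_on_reduced d (Z : R -> 'M[R]_(n, d)) : sm U Z ->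
  skew_on U (eF E Z Z) (aF E A Z Z).
Proof. by move=> sZ t Ut; rewrite tr_eF // tr_aF. Qed.

Lemma eF_reduced d e1 e2 (Z : R -> 'M[R]_(n, d)) (X : R -> 'M[R]_(d, e1))
    (Y : R -> 'M[R]_(d, e2)) t :
  eF E (fun s => Z s *m X s) (fun s => Z s *m Y s) t = eF (eF E Z Z) X Y t.
Proof. by rewrite /eF trmx_mul !mulmxA. Qed.

Lemma aF_reduced d e1 e2 (Z : R -> 'M[R]_(n, d)) (X : R -> 'M[R]_(d, e1))
    (Y : R -> 'M[R]_(d, e2)) t : sm U Z -> sm U Y -> U t ->
  aF E A (fun s => Z s *m X s) (fun s => Z s *m Y s) t =
  aF (eF E Z Z) (aF E A Z Z) X Y t.
Proof. by move=> sZ sY Ut; rewrite aF_mul. Qed.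

End Calculus.

(* Uniqueness of solutions enters only through the absence of nonzero
   compactly supported solutions; this survives the passage to subintervals
   and to reduced systems, each reduction costing one derivative. *)
Definition no_compact_sol m U n (E A : R -> 'M[R]_n) :=
  forall x : R -> 'cV[R]_n, mck m U x ->
    (exists c d : R, (forall t, c <= t <= d -> U t) /\
       forall t, ~~ (c <= t <= d) -> x t = 0) ->
    (forall t, U t -> E t *m dmx x t = A t *m x t) -> forall t, x t = 0.

Lemma open_outside (c d : R) : open [set t | ~~ (c <= t <= d)].
Proof.
rewrite (_ : [set t | _] = [set t | t < c] `|` [set t | d < t]).
  by apply: openU; [exact: open_lt|exact: open_gt].
apply/seteqP; split=> t /=; rewrite negb_and -!ltNge.
  by case/orP; [left|right].
by case=> ->; rewrite ?orbT.
Qed.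

Lemma dmx_outside d1 d2 (x : R -> 'M[R]_(d1, d2)) (c d t : R) :
  (forall t, ~~ (c <= t <= d) -> x t = 0) -> ~~ (c <= t <= d) -> dmx x t = 0.
Proof.
move=> x0 ht; have oO := @open_outside c d.
by rewrite (@eq_dmx _ _ _ _ x (fun=> 0) t oO ht) ?dmx_cst.
Qed.

(** [U'] and the open complement of [c, d] cover the line, and the function is zero on the
    latter. *)
Lemma mck_extend k U U' d1 d2 (x : R -> 'M[R]_(d1, d2)) (c d : R) :
  (forall t, c <= t <= d -> U' t) -> (forall t, ~~ (c <= t <= d) -> x t = 0) ->
  mck k U' x -> mck k U x.
Proof.
move=> sU' x0 cx i j; apply: ck_cover => t _.
have [/sU' U't|out] := boolP (c <= t <= d); first by exists U'.
exists [set t | ~~ (c <= t <= d)] => //.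
apply: eq_ck (ck_cst k _ 0); first exact: open_outside.
by move=> s /= /x0 ->; rewrite mxE.
Qed.

Lemma no_compact_sol_sub m U U' n (E A : R -> 'M[R]_n) :
  U' `<=` U -> no_compact_sol m U E A -> no_compact_sol m U' E A.
Proof.
move=> sU H x cx [c [d [sU' x0]]] eqx.
apply: H.
- exact: mck_extend sU' x0 cx.
- by exists c, d; split=> // t /sU' /sU.
move=> t Ut; have [/sU' /eqx //|out] := boolP (c <= t <= d).
by rewrite (dmx_outside x0) // x0 // !mulmx0.
Qed.

Lemma ex_itv_open U : open U -> U !=set0 ->
  exists c d : R, c < d /\ forall t, c <= t <= d -> U t.
Proof.
move=> oU [t Ut]; have /nbhs_ballP[e /= e0 he] := open_nbhs_nbhs (conj oU Ut).
exists (t - e / 2), (t + e / 2); split; first by rewrite ltrBlDr -addrA ltrDl addr_gt0 ?divr_gt0.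
move=> s /andP[s1 s2]; apply: he; rewrite /ball /= distrC ltr_distl.
have e2 : e / 2 < e by rewrite gtr_pMr // invf_lt1 // ltr1n.
apply/andP; split; first by apply: lt_le_trans s1; rewrite ltrD2l ltrN2.
by apply: le_lt_trans s2 _; rewrite ltrD2l.
Qed.

(** In (phi v)' = phi' v + phi v' the first term is killed by E v = 0, so any scalar multiple of [v]
    is again a solution. *)
Lemma kernel_field_compact_sol m U n (E A : R -> 'M[R]_n) (v : R -> 'cV[R]_n) :
  open U -> U !=set0 -> sm U v ->
  (forall t, U t -> [/\ v t != 0, E t *m v t = 0 & E t *m dmx v t = A t *m v t]) ->
  ~ no_compact_sol m U E A.
Proof.
move=> oU U0 sv Hv /(_ _) H.
have [c [d [cd sU]]] := ex_itv_open oU U0.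
(* Class m+1 provides the one derivative needed by the product rule even when m = 0. *)
have [phi [cphi phi0 [t0 /andP[t1 t2] phi1]]] := exists_bump m.+1 cd.
have cphiU : ck m.+1 U phi by exact: ck_sub cphi.
have t0cd : c <= t0 <= d by rewrite !ltW.
have := H (fun t => phi t *: v t) _ _ _ t0; rewrite -/(_ = _).
case: (Hv t0 (sU _ t0cd)) => v0 _ _ K.
suff /eqP : phi t0 *: v t0 = 0 by rewrite scaler_eq0 (negPf phi1) (negPf v0).
apply: K.
- by apply: mckZ => //; exact: ckW.
- by exists c, d; split=> // t /phi0 ->; rewrite scale0r.
move=> t Ut; have [_ Ev EAv] := Hv t Ut.
rewrite (dmxZ (U := U)) //; last by apply: ck_sub (_ : ck 1 U phi) => //; elim: (m) cphiU => // k IH /ckW.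
by rewrite mulmxDr -!scalemxAr Ev scaler0 add0r EAv.
Qed.

(** A compactly supported solution z of the pair reduced to [Z] lifts to x = Z z + V v, with v
    chosen to satisfy the [Y] equations. As v contains z', the lift has one class less than z. *)
Lemma no_compact_sol_reduced m U n k d s l (E A : R -> 'M[R]_n)
    (Y : R -> 'M[R]_(n, k)) (Z : R -> 'M[R]_(n, d)) (W : R -> 'M[R]_(n, s))
    (V : R -> 'M[R]_(n, l)) (K : R -> 'M[R]_(l, k)) :
  open U -> sm U E -> sm U A -> skew_on U E A ->
  sm U Y -> sm U Z -> sm U V -> sm U K ->
  (forall t, U t ->
    [/\ E t *m W t = 0, E t *m V t = 0, aF E A Y V t *m K t = 1%:M &
     [/\ aF E A Z V t = 0, aF E A W Z t = 0, aF E A W V t = 0,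
         aF E A V Z t = 0 & aF E A V V t = 0]]) ->
  (forall t, U t -> exists G1 G2 G3 G4,
     Y t *m G1 + Z t *m G2 + W t *m G3 + V t *m G4 = 1%:M) ->
  (forall t, U t -> exists L, L *m Z t = 1%:M /\ L *m V t = 0) ->
  no_compact_sol m.+1 U E A -> no_compact_sol m.+2 U (eF E Z Z) (aF E A Z Z).
Proof.
move=> oU sE sA sk sY sZ sV sK Hf span left H z cz [c [e [sU z0]]] eqz.
pose v t := K t *m (eF E Y Z t *m dmx z t - aF E A Y Z t *m z t).
pose x t := Z t *m z t + V t *m v t.
have cz' := mckW cz.
have cv : mck m.+1 U v.
  apply: mckM => //; apply: mckD => //.
    by apply: mckM => //; [exact: sm_eF|exact: mck_dmx].
  by apply: mckN => //; apply: mckM => //; exact: sm_aF.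
have hv t : U t -> aF E A Y V t *m v t = eF E Y Z t *m dmx z t - aF E A Y Z t *m z t.
  by move=> /Hf[_ _ YVK _]; rewrite mulmxA YVK mul1mx.
have v0 t : ~~ (c <= t <= e) -> v t = 0.
  by move=> out; rewrite /v (dmx_outside z0) // z0 // !mulmx0 subrr mulmx0.
clearbody v.
have cx : mck m.+1 U x by apply: mckD => //; exact: mckM.
have zx t : x t = 0 -> z t = 0.
  move=> xt; have [/sU Ut|/z0 //] := boolP (c <= t <= e).
  have [L [LZ LV]] := left t Ut.
  have <- : L *m x t = z t; last by rewrite xt mulmx0.
  by rewrite mulmxDr (mulmxA L (Z t)) (mulmxA L (V t)) LZ LV mul1mx mul0mx addr0.
have x0 t : ~~ (c <= t <= e) -> x t = 0.
  by move=> out; rewrite /x v0 // z0 // !mulmx0 addr0.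
suff : forall t, x t = 0 by move=> x00 t; exact: zx.
apply: H => //; first by exists c, e.
move=> t Ut; apply/eqP; rewrite -subr_eq0; apply/eqP.
have [EW EV YVK [ZV WZ WV VZ VV]] := Hf t Ut.
have m1 d1 d2 (M : R -> 'M[R]_(d1, d2)) k' : mck k'.+1 U M -> mck 1 U M.
  by elim: k' => // k' IH /mckW.
have v1 := m1 _ _ _ _ cv; have z1 := m1 _ _ _ _ cz.
have dx : dmx x t = dmx Z t *m z t + Z t *m dmx z t + (dmx V t *m v t + V t *m dmx v t).
  rewrite (dmxD (mckM oU (sZ 1%N) z1) (mckM oU (sV 1%N) v1) Ut).
  by rewrite (dmxM (sZ 1%N) z1 Ut) (dmxM (sV 1%N) v1 Ut).
(* The derivative of v drops out because E V = 0, so v enters only algebraically. *)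
have res e1 (X : R -> 'M[R]_(n, e1)) : (X t)^T *m (E t *m dmx x t - A t *m x t) =
    eF E X Z t *m dmx z t - aF E A X Z t *m z t - aF E A X V t *m v t.
  rewrite dx /x /eF /aF mulmxBr !mulmxA !mulmxDr !mulmxBl !mulmxA.
  rewrite -[(X t)^T *m E t *m V t]mulmxA EV mulmx0 mul0mx addr0.
  set p := _ *m dmx Z t *m _; set q := _ *m dmx z t; set r := _ *m dmx V t *m _.
  set a := _ *m A t *m _ *m z t; set b := _ *m A t *m _ *m v t.
  by rewrite !opprB opprD addrACA [p + q]addrC !addrA.
have tW : (W t)^T *m E t = 0.
  by apply: trmx_inj; rewrite trmx_mul trmxK (sk t Ut).1 EW trmx0.
have tV : (V t)^T *m E t = 0.
  by apply: trmx_inj; rewrite trmx_mul trmxK (sk t Ut).1 EV trmx0.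
have [G1 [G2 [G3 [G4 HG]]]] := span t Ut.
move: res; set r := E t *m dmx x t - A t *m x t; clearbody r => res.
(* The residual is tested against the basis: [Y] vanishes by the choice of v, [Z] by the reduced
   equation, [W] and [V] by the zero blocks. *)
rewrite -[LHS]mul1mx -trmx1 -HG !raddfD /= !trmx_mul !mulmxDl -!mulmxA !res.
rewrite ZV WZ WV VZ VV [eF E W Z t](_ : _ = 0); last by rewrite /eF tW mul0mx.
rewrite [eF E V Z t](_ : _ = 0); last by rewrite /eF tV mul0mx.
rewrite eqz // subrr hv // subrr.
by rewrite !mul0mx !subr0 !mulmx0 !addr0.
Qed.

End CongruenceForms.

(** * Splitting off the kernel of E and the skew form that A induces on it *)

Section Reduction.
Variable R : realType.
Implicit Types (U : set R) (n m k : nat).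

(** Here [eF] must vanish on the whole open set, since [tr_aF] involves its derivative. *)
Lemma aF_transpose_eq0 U n d1 d2 (E A : R -> 'M[R]_n) (X : R -> 'M[R]_(n, d1))
    (Y : R -> 'M[R]_(n, d2)) t :
  open U -> sm U E -> sm U A -> skew_on U E A -> sm U X -> sm U Y ->
  (forall t, U t -> eF E X Y t = 0) -> U t -> aF E A X Y t = 0 -> aF E A Y X t = 0.
Proof.
move=> oU sE sA sk sX sY EXY Ut XY; apply: trmx_inj.
rewrite (tr_aF oU sE sk) // XY trmx0 oppr0 sub0r.
by rewrite (@eq_dmx _ U _ _ _ (fun=> 0)) ?dmx_cst ?oppr0.
Qed.

Lemma eF_ker n d1 d2 (E : R -> 'M[R]_n) (X : R -> 'M[R]_(n, d1))
    (Y : R -> 'M[R]_(n, d2)) t : E t *m Y t = 0 -> eF E X Y t = 0.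
Proof. by move=> EY; rewrite /eF -mulmxA EY mulmx0. Qed.

Lemma eF_kerl U n d1 d2 (E A : R -> 'M[R]_n) (X : R -> 'M[R]_(n, d1))
    (Y : R -> 'M[R]_(n, d2)) t : skew_on U E A -> U t ->
  E t *m X t = 0 -> eF E X Y t = 0.
Proof.
by move=> sk Ut EX; apply: trmx_inj; rewrite (tr_eF sk) // eF_ker // trmx0.
Qed.

(** On the kernel of E the [eF] blocks vanish, so there [aF] is skew and changes by plain
    congruence; [exists_skew_frame] splits this kernel into [W] and [V]. *)
Lemma exists_index_frames U n (E A : R -> 'M[R]_n) :
  open U -> U !=set0 -> sm U E -> sm U A -> skew_on U E A ->
  exists U' p q s k (F : R -> 'M[R]_(n, p + q)) (W : R -> 'M[R]_(n, s))
    (V : R -> 'M[R]_(n, k)),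
  [/\ open U', U' !=set0, U' `<=` U, n = (p + q + s + k)%N &
   [/\ sm U' F, sm U' W, sm U' V & forall t, U' t ->
    [/\ [/\ eF E F F t = signature_mx R p q, E t *m W t = 0 & E t *m V t = 0],
        aF E A W W t \in unitmx, aF E A W F t = 0,
        [/\ aF E A W V t = 0, aF E A V W t = 0 & aF E A V V t = 0]
      & exists G1 G2 G3, F t *m G1 + W t *m G2 + V t *m G3 = 1%:M]]].
Proof.
move=> oU U0 sE sA sk.
have [U1 [p [q [r [F0 [V0 [oU1 U10 sU1 er [sF0 sV0 H1]]]]]]]] :=
  exists_signature_frame oU U0 sE (fun t Ut => (sk t Ut).1).
have {}sE := sm_sub sU1 sE; have {}sA := sm_sub sU1 sA; have {}sk := skew_on_sub sU1 sk.
have EV0 t : U1 t -> E t *m V0 t = 0 by case/H1.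
have eV0 t d (X : R -> 'M[R]_(n, d)) : U1 t -> eF E X V0 t = 0.
  by move=> Ut; apply: eF_ker; exact: EV0.
have sB : sm U1 (aF E A V0 V0) by exact: sm_aF.
have skB t : U1 t -> (aF E A V0 V0 t)^T = - aF E A V0 V0 t.
  move=> Ut; rewrite (tr_aF oU1 sE sk) //.
  rewrite (@eq_dmx _ U1 _ _ _ (fun=> 0)) ?dmx_cst ?subr0 // => u Uu; exact: eV0.
have [U2 [s [k [P [K [oU2 U20 sU2 er' [sP sK H2]]]]]]] := exists_skew_frame oU1 U10 sB skB.
have {}sE := sm_sub sU2 sE; have {}sA := sm_sub sU2 sA; have {}sk := skew_on_sub sU2 sk.
have {}sF0 := sm_sub sU2 sF0; have {}sV0 := sm_sub sU2 sV0.
pose W t : 'M[R]_(n, s) := V0 t *m P t; pose V t : 'M[R]_(n, k) := V0 t *m K t.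
have sW : sm U2 W by exact: smM.
have sV : sm U2 V by exact: smM.
have EW t : U2 t -> E t *m W t = 0 by move=> Ut; rewrite mulmxA EV0 ?mul0mx //; exact: sU2.
have EV t : U2 t -> E t *m V t = 0 by move=> Ut; rewrite mulmxA EV0 ?mul0mx //; exact: sU2.
have V0aF d1 d2 (X : R -> 'M[R]_(r, d1)) (Y : R -> 'M[R]_(r, d2)) t : sm U2 Y -> U2 t ->
    aF E A (fun s => V0 s *m X s) (fun s => V0 s *m Y s) t = (X t)^T *m aF E A V0 V0 t *m Y t.
  move=> sY Ut; rewrite (aF_mul (U := U2)) // [eF _ _ _ _]eV0 ?mulmx0 ?mul0mx ?subr0 //.
  exact: sU2.
have BK t : U2 t -> aF E A V0 V0 t *m K t = 0 by case/H2.
have WW t : U2 t -> aF E A W W t \in unitmx.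
  by move=> Ut; rewrite V0aF //; case: (H2 t Ut).
have WV t : U2 t -> aF E A W V t = 0 by move=> Ut; rewrite V0aF // -mulmxA BK ?mulmx0.
have VV t : U2 t -> aF E A V V t = 0 by move=> Ut; rewrite V0aF // -mulmxA BK ?mulmx0.
have VW t : U2 t -> aF E A V W t = 0.
  by move=> Ut; apply: (aF_transpose_eq0 (U := U2)) => //; [move=> u /EV; exact: eF_ker|exact: WV].
have sWW : sm U2 (fun t => invmx (aF E A W W t)).
  by apply: sm_inv => //; exact: sm_aF.
(* Block elimination with the invertible pivot aF W W: subtracting W C from [F0] clears the coupling
   of [W] to [F] and leaves E F unchanged, as E W = 0. *)
pose C t : 'M[R]_(s, p + q) := invmx (aF E A W W t) *m aF E A W F0 t.
have sC : sm U2 C by apply: smM => //; exact: sm_aF.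
pose F t : 'M[R]_(n, p + q) := F0 t - W t *m C t.
have sF : sm U2 F by apply: smD => //; apply: smN => //; exact: smM.
have EF t : U2 t -> E t *m F t = E t *m F0 t.
  by move=> Ut; rewrite mulmxBr mulmxA EW // mul0mx subr0.
have FF t : U2 t -> eF E F F t = signature_mx R p q.
  move=> Ut; have [<- _ _] := H1 t (sU2 t Ut).
  rewrite /eF -!mulmxA EF //; apply: trmx_inj; rewrite !trmx_mul !trmxK (sk t Ut).1.
  by rewrite -!mulmxA EF.
exists U2, p, q, s, k, F, W, V; split=> //; first exact: subset_trans sU1.
  by rewrite er er' addnA.
split=> // t Ut; split=> //; last 2 first.
- by rewrite WV // VW // VV.
- have [_ _ [G1 [G2 HG]]] := H1 t (sU2 t Ut); have [_ _ [L1 [L2 HL]]] := H2 t Ut.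
  exists G1, (C t *m G1 + L1 *m G2), (L2 *m G2).
  have WL : W t *m L1 + V t *m L2 = V0 t by rewrite -!mulmxA -mulmxDr HL mulmx1.
  rewrite mulmxBl (mulmxDr (W t)) (mulmxA (W t)) addrA subrK.
  by rewrite (mulmxA (W t)) (mulmxA (V t)) -addrA -mulmxDl WL.
- by rewrite FF // EW // EV.
- exact: WW.
rewrite (_ : aF E A W F t = aF E A W F0 t - aF E A W (fun s => W s *m C s) t).
  rewrite (aF_mulr (U := U2)) // (eF_ker _ (EW t Ut)) mul0mx subr0.
  by rewrite mulmxA mulmxV ?WW // mul1mx subrr.
have c1 : mck 1 U2 (fun s => - (W s *m C s)) by apply: mckN => //; apply: mckM.
rewrite /aF (dmxD (sF0 1%N) c1 Ut) (dmxN (M := fun s => W s *m C s) (U := U2)) //; last first.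
  exact: mckM.
by rewrite !mulmxBr opprD addrACA -opprD.
Qed.

(** For a square matrix the right inverse is also a left inverse; the claims are blocks of that
    second identity. *)
Lemma square4_left_inverse n k d l r (Y : 'M[R]_(n, k)) (Z : 'M[R]_(n, d))
    (W : 'M[R]_(n, l)) (V : 'M[R]_(n, r)) G1 G2 G3 G4 :
  n = (k + d + (l + r))%N -> Y *m G1 + Z *m G2 + W *m G3 + V *m G4 = 1%:M ->
  [/\ G2 *m Z = 1%:M, G2 *m V = 0 & G4 *m V = 1%:M].
Proof.
move=> en HG.
have : row_mx (row_mx Y Z) (row_mx W V) *m col_mx (col_mx G1 G2) (col_mx G3 G4) = 1%:M.
  by rewrite !mul_row_col addrA.
move=> /(square_mulmx1C en); rewrite mul_col_row scalar_mx_block.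
move=> /eq_block_mx[]; rewrite !mul_col_row => H1 H2 _ H3.
move: H1; rewrite scalar_mx_block => /eq_block_mx[_ _ _ ->].
move: H2; rewrite -[0 in RHS]block_mx0 => /eq_block_mx[_ _ _ ->].
by move: H3; rewrite scalar_mx_block => /eq_block_mx[_ _ _ ->].
Qed.

Lemma unitmx_block_diag m n (A : 'M[R]_m) (D : 'M[R]_n) :
  A \in unitmx -> D \in unitmx -> block_mx A 0 0 D \in unitmx.
Proof. by rewrite !unitmxE det_ublock unitrM => -> ->. Qed.

End Reduction.

(** * The anti-triangular form *)

Section Antitriangular.
Variable R : realType.
Implicit Types (w k m n i j : nat) (rs cs : nat -> nat).

Lemma ent_in m n (M : 'M[R]_(m, n)) (i : 'I_m) (j : 'I_n) : ent M i j = M i j.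
Proof. by rewrite /ent !valK. Qed.

Lemma ent_ur m1 m2 n1 n2 (A : 'M[R]_(m1, n1)) B C (D : 'M[R]_(m2, n2)) i j :
  (i < m1)%N -> (j < n2)%N -> ent (block_mx A B C D) i (n1 + j)%N = ent B i j.
Proof.
move=> hi hj; rewrite (ent_in B (Ordinal hi) (Ordinal hj)) -(block_mxEur A B C D).
by rewrite -ent_in.
Qed.

Lemma ent_dl m1 m2 n1 n2 (A : 'M[R]_(m1, n1)) B C (D : 'M[R]_(m2, n2)) i j :
  (i < m2)%N -> (j < n1)%N -> ent (block_mx A B C D) (m1 + i)%N j = ent C i j.
Proof.
move=> hi hj; rewrite (ent_in C (Ordinal hi) (Ordinal hj)) -(block_mxEdl A B C D).
by rewrite -ent_in.
Qed.

Lemma ent_dr m1 m2 n1 n2 (A : 'M[R]_(m1, n1)) B C (D : 'M[R]_(m2, n2)) i j :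
  (i < m2)%N -> (j < n2)%N -> ent (block_mx A B C D) (m1 + i)%N (n1 + j)%N = ent D i j.
Proof.
move=> hi hj; rewrite (ent_in D (Ordinal hi) (Ordinal hj)) -(block_mxEdr A B C D).
by rewrite -ent_in.
Qed.

Lemma ent0 m n i j : ent (0 : 'M[R]_(m, n)) i j = 0.
Proof. by rewrite /ent; case: insub => // a; case: insub => // b; rewrite mxE. Qed.

Lemma ent1 n i j : (i < n)%N -> (j < n)%N -> ent (1%:M : 'M[R]_n) i j = (i == j)%:R.
Proof. by move=> hi hj; rewrite (ent_in _ (Ordinal hi) (Ordinal hj)) mxE. Qed.

Lemma psum_lt rs w i u : (i < w)%N -> (u < rs i)%N ->
  (\sum_(l < i) rs l + u < \sum_(l < w) rs l)%N.
Proof.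
elim: w => // w IH; rewrite ltnS leq_eqVlt big_ord_recr /=.
case/orP => [/eqP -> ui|iw /(IH iw)]; first by rewrite ltn_add2l.
by move=> h; apply: leq_trans h (leq_addr _ _).
Qed.

(** Entries are addressed by natural number offsets, so that no cast along the sums of block sizes
    occurs. Block indices start at 0, so the antidiagonal is i + k + 1 = w. *)
Definition antitriangular w rs cs m n (M N : 'M[R]_(m, n)) :=
  [/\ m = (\sum_(i < w) rs i)%N, n = (\sum_(k < w) cs k)%N,
   forall i k, (i < w)%N -> (k < w)%N -> (i + k + 1)%N = w -> rs i = cs k &
   forall i k u v, (i < w)%N -> (k < w)%N -> (u < rs i)%N -> (v < cs k)%N ->
     let a := (\sum_(l < i) rs l + u)%N in let b := (\sum_(l < k) cs l + v)%N in
     [/\ (w <= i + k + 1)%N -> ent M a b = 0,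
         (w < i + k + 1)%N -> ent N a b = 0 &
         (i + k + 1)%N = w -> ent N a b = (u == v)%:R]].

(** The new block row goes on top and the new block column to the right. An old block (i, j) moves
    to (i+1, j), keeping its position relative to the antidiagonal as w grows by one; the new
    identity sits in the corner (0, w), and the blocks left of it are unconstrained. *)
Lemma antitriangular_border w rs cs m n k (M N : 'M[R]_(m, n))
    (X Y : 'M[R]_(k, n)) :
  antitriangular w rs cs M N ->
  antitriangular w.+1 (fun i => if i is i'.+1 then rs i' else k)
    (fun j => if (j < w)%N then cs j else k)
    (block_mx X (0 : 'M[R]_(k, k)) M 0) (block_mx Y 1%:M N 0).
Proof.
move=> [em en ec H].
have sumr i : (\sum_(l < i.+1) (if (l : nat) is l'.+1 then rs l' else k) =
    k + \sum_(l < i) rs l)%N by rewrite big_ord_recl.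
have sumc j : (j <= w)%N ->
    (\sum_(l < j) (if l < w then cs l else k) = \sum_(l < j) cs l)%N.
  by move=> jw; apply: eq_bigr => l _; rewrite (leq_trans (ltn_ord l) jw).
split; first by rewrite sumr em.
- by rewrite big_ord_recr /= sumc // ltnn en.
- move=> [|i] j hi hj e; rewrite ltnS in hj.
    by rewrite ifF //; lia.
  by rewrite ifT; [apply: ec|]; lia.
move=> [|i] j u v hi; rewrite ltnS => hj hu; rewrite sumc // => hv.
  rewrite big_ord0 add0n; move: hj hv; rewrite leq_eqVlt => /orP[/eqP -> |jw].
    rewrite ltnn -en => hv; split=> [_|h|_].
    - by rewrite ent_ur // ent0.
    - by lia.
    - by rewrite ent_ur // ent1.
  by rewrite jw => hv; split; lia.
rewrite sumr -addnA; move: hj hv; rewrite leq_eqVlt => /orP[/eqP -> |jw].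
  rewrite ltnn -en => hv; have hi' : (i < w)%N by []; have ha := psum_lt hi' hu; rewrite -em in ha.
  by split; [move=> _|move=> _|lia]; rewrite ent_dr ?ent0.
rewrite jw => hv; have hi' : (i < w)%N by []; have [H1 H2 H3] := H i j u v hi' jw hu hv.
have ha := psum_lt hi' hu; have hb := psum_lt jw hv.
rewrite -em in ha; rewrite -en in hb.
by split=> h; rewrite ent_dl //; [apply: H1|apply: H2|apply: H3]; lia.
Qed.

End Antitriangular.

(** * The recursion that produces the columns of Q *)

Section NormalFrames.
Variable R : realType.
Implicit Types (U : set R).

(** Of each transposed pair of zero blocks only one is recorded; the other follows from
    skew-adjointness. *)
Definition normal_frames U n (E A : R -> 'M[R]_n) n1 p q n3 n4 w (rs cs : nat -> nat)
    (F1 : R -> 'M[R]_(n, n1)) (F2 : R -> 'M[R]_(n, p + q))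
    (F3 : R -> 'M[R]_(n, n3)) (F4 : R -> 'M[R]_(n, n4)) :=
  [/\ n = (n1 + (p + q) + n3 + n4)%N,
    [/\ sm U F1, sm U F2, sm U F3 & sm U F4] & forall t, U t ->
    [/\ [/\ eF E F2 F2 t = signature_mx R p q, eF E F2 F3 t = 0, eF E F2 F4 t = 0,
           eF E F3 F3 t = 0 & (eF E F3 F4 t = 0 /\ eF E F4 F4 t = 0)],
        [/\ aF E A F2 F3 t = 0, aF E A F2 F4 t = 0, aF E A F3 F4 t = 0 &
           aF E A F4 F4 t = 0],
        aF E A F3 F3 t \in unitmx,
        antitriangular w rs cs (eF E F1 F4 t) (aF E A F1 F4 t) &
        exists G1 G2 G3 G4,
          F1 t *m G1 + F2 t *m G2 + F3 t *m G3 + F4 t *m G4 = 1%:M]].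

(** Induction on a bound of the dimension, as one reduction may remove many dimensions. The class
    [m] is kept general because it grows with each reduction. *)
Lemma exists_normal_frames N n m U (E A : R -> 'M[R]_n) : (n <= N)%N ->
  open U -> U !=set0 -> sm U E -> sm U A -> skew_on U E A ->
  no_compact_sol m.+1 U E A ->
  exists U' n1 p q n3 n4 w rs cs (F1 : R -> 'M[R]_(n, n1))
    (F2 : R -> 'M[R]_(n, p + q)) (F3 : R -> 'M[R]_(n, n3)) (F4 : R -> 'M[R]_(n, n4)),
   [/\ open U', U' !=set0, U' `<=` U & normal_frames U' E A w rs cs F1 F2 F3 F4].
Proof.
elim: N n m U E A => [|N IH] n m U E A nN oU U0 sE sA sk nc.
  exists U, 0%N, 0%N, 0%N, 0%N, 0%N, 0%N, (fun=> 0%N), (fun=> 0%N),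
    (fun=> 0), (fun=> 0), (fun=> 0), (fun=> 0).
  move: nN; rewrite leqn0 => /eqP n0.
  split=> //; split=> //; first by split; exact: sm_cst.
  move=> t Ut; split.
  - by do ?split; exact: mx0_eq.
  - by split; exact: mx0_eq.
  - by rewrite unitmxE det_mx00 unitr1.
  - by split=> //; rewrite big_ord0.
  by subst n; exists 0, 0, 0, 0; exact: mx0_eq.
have [U1 [p [q [s [k [F [W [V [oU1 U10 sU1 en [sF sW sV H]]]]]]]]]] :=
  exists_index_frames oU U0 sE sA sk.
have {}sE := sm_sub sU1 sE; have {}sA := sm_sub sU1 sA; have {}sk := skew_on_sub sU1 sk.
have {}nc := no_compact_sol_sub sU1 nc.
(* With no columns in [V] the recursion stops, with w = 0 and empty outer frames. *)
case: (posnP k) => [k0|k_gt0].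
  subst k; exists U1, 0%N, p, q, s, 0%N, 0%N, (fun=> 0%N), (fun=> 0%N), (fun=> 0), F, W, V.
  split=> //; split; first by rewrite en add0n.
    by split=> //; exact: sm_cst.
  move=> t Ut; have [[FF EW EV] uW WF [WV VW VV] [G1 [G2 [G3 HG]]]] := H t Ut.
  split=> //.
  - by split; try split; first exact: FF; exact: eF_ker.
  - split; try exact: mxn0_eq.
    by apply: (aF_transpose_eq0 (U := U1)) => // u Uu; have [[_ EWu _] _ _ _ _] := H u Uu; exact: (eF_kerl _ sk).
  - by split=> //; rewrite big_ord0.
  by exists 0, G1, G2, G3; rewrite mul0mx add0r.
pose M := aF E A F V.
have sM : sm U1 M by exact: sm_aF.
have [U2 [oU2 U20 sU2 [[v sv Hv]|[d [C [D [ed sC sD HCD]]]]]]] :=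
  kernel_field_or_section oU1 U10 sM.
  (* A kernel field v of M makes V v a solution in the kernel of E: its residual vanishes against
     [F] by M v = 0 and against [W], [V] by the zero blocks. *)
  exfalso; have {}sE := sm_sub sU2 sE; have {}sA := sm_sub sU2 sA.
  have {}nc := no_compact_sol_sub sU2 nc; have {}sV := sm_sub sU2 sV.
  apply: (@kernel_field_compact_sol _ m.+1 U2 n E A (fun t => V t *m v t)) nc => //.
    exact: smM.
  move=> t Ut; have [v0 Mv] := Hv t Ut.
  have [[FF EW EV] uW WF [WV VW VV] [G1 [G2 [G3 HG]]]] := H t (sU2 t Ut).
  split.
  - apply/eqP => Vv; case/eqP: v0.
    have en0 : n = (0 + (p + q) + (s + k))%N by rewrite en add0n addnA.
    have HG0 : (0 : 'M[R]_(n, 0%N)) *m (0 : 'M[R]_(0%N, n)) + F t *m G1 + W t *m G2 + V t *m G3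
      = 1%:M by rewrite mulmx0 add0r.
    have [_ _ GV] := square4_left_inverse en0 HG0.
    by rewrite -[v t]mul1mx -GV -mulmxA Vv mulmx0.
  - by rewrite mulmxA EV mul0mx.
  have aFv e (X : R -> 'M[R]_(n, e)) : aF E A X V t *m v t = 0 ->
      (X t)^T *m (A t *m (V t *m v t) - E t *m dmx (fun s => V s *m v s) t) = 0.
    have := @aF_mulr R U2 n E A e k 1 X V v t sV sv Ut.
    by rewrite (eF_ker _ EV) mul0mx subr0 => <-; rewrite /aF mulmxBr !mulmxA.
  apply/eqP; rewrite eq_sym -subr_eq0; apply/eqP; rewrite -[LHS]mul1mx -trmx1 -HG.
  move: aFv; set r := (_ - _); clearbody r => aFv.
  rewrite !raddfD /= !trmx_mul !mulmxDl -!mulmxA.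
  by rewrite !aFv ?WV ?VV ?mul0mx ?mulmx0 ?addr0.
have {}sE := sm_sub sU2 sE; have {}sA := sm_sub sU2 sA; have {}sk := skew_on_sub sU2 sk.
have {}nc := no_compact_sol_sub sU2 nc; have {}sV := sm_sub sU2 sV.
have {}sF := sm_sub sU2 sF; have {}sW := sm_sub sU2 sW.
(* [C] and [D] are chosen so that aF Y V = C^T M = 1 and aF Z V = D^T M = 0. *)
pose Y t : 'M[R]_(n, k) := F t *m C t; pose Z t : 'M[R]_(n, d) := F t *m D t.
have sY : sm U2 Y by exact: smM.
have sZ : sm U2 Z by exact: smM.
have EW t : U2 t -> E t *m W t = 0 by move=> /sU2/H[[]].
have EV t : U2 t -> E t *m V t = 0 by move=> /sU2/H[[]].
have VV t : U2 t -> aF E A V V t = 0 by move=> /sU2/H[_ _ _ []].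
have WV t : U2 t -> aF E A W V t = 0 by move=> /sU2/H[_ _ _ []].
have YV t : U2 t -> aF E A Y V t = 1%:M by move=> Ut; rewrite aF_mull; case: (HCD t Ut).
have ZV t : U2 t -> aF E A Z V t = 0 by move=> Ut; rewrite aF_mull; case: (HCD t Ut).
have WZ t : U2 t -> aF E A W Z t = 0.
  move=> Ut; have [_ _ WF _ _] := H t (sU2 t Ut).
  by rewrite (aF_mulr (U := U2)) // WF mul0mx (eF_kerl _ sk) ?EW // mul0mx subr0.
have ZW t : U2 t -> aF E A Z W t = 0.
  move=> Ut; apply: (aF_transpose_eq0 (U := U2)) => //; last exact: WZ.
  by move=> u Uu; apply: (eF_kerl _ sk) => //; exact: EW.
have VZ t : U2 t -> aF E A V Z t = 0.
  by move=> Ut; apply: (aF_transpose_eq0 (U := U2)) => //; [move=> u /EV; exact: eF_ker|exact: ZV].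
have span t : U2 t -> exists G1 G2 G3 G4,
    Y t *m G1 + Z t *m G2 + W t *m G3 + V t *m G4 = 1%:M.
  move=> Ut; have [_ _ _ _ [G1 [G2 [G3 HG]]]] := H t (sU2 t Ut).
  have [_ _ [L1 [L2 HL]]] := HCD t Ut.
  exists (L1 *m G1), (L2 *m G1), G2, G3; rewrite -HG; congr (_ + _ + _).
  by rewrite -!mulmxA -mulmxDr !mulmxA -mulmxDl HL mul1mx.
have en' : n = (k + d + (s + k))%N by rewrite en ed addnA.
have ncr : no_compact_sol m.+2 U2 (eF E Z Z) (aF E A Z Z).
  apply: (@no_compact_sol_reduced _ m U2 n k d s k E A Y Z W V (fun=> 1%:M)) => //.
  - exact: sm_cst.
  - move=> t Ut; split; [exact: EW|exact: EV|by rewrite YV ?mulmx1|].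
    by split; [exact: ZV|exact: WZ|exact: WV|exact: VZ|exact: VV].
  move=> t Ut; have [G1 [G2 [G3 [G4 HG]]]] := span t Ut; exists G2.
  by have [] := square4_left_inverse en' HG.
have dN : (d <= N)%N by lia.
have [U3 [n1 [p' [q' [n3 [n4 [w [rs [cs [f1 [f2 [f3 [f4 [oU3 U30 sU3 [ed' [sf1 sf2 sf3 sf4] Hf]]]]]]]]]]]]]]] :=
  IH d m.+1 U2 _ _ dN oU2 U20 (sm_eF oU2 sE sZ sZ) (sm_aF oU2 sE sA sZ sZ)
    (skew_on_reduced oU2 sE sk sZ) ncr.
have {}sE := sm_sub sU3 sE; have {}sA := sm_sub sU3 sA; have {}sk := skew_on_sub sU3 sk.
have {}sY := sm_sub sU3 sY; have {}sZ := sm_sub sU3 sZ.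
have {}sV := sm_sub sU3 sV; have {}sW := sm_sub sU3 sW.
clearbody Y Z.
(* [Y] is put in front of the first frame and [V] at the end of the last; their pairing, the
   identity, becomes the new antidiagonal corner. [W] enlarges the Sigma part. *)
exists U3, (k + n1)%N, p', q', (n3 + s)%N, (n4 + k)%N, w.+1,
  (fun i => if i is i'.+1 then rs i' else k),
  (fun j => if (j < w)%N then cs j else k),
  (fun t => row_mx (Y t) (Z t *m f1 t)), (fun t => Z t *m f2 t),
  (fun t => row_mx (Z t *m f3 t) (W t)), (fun t => row_mx (Z t *m f4 t) (V t)).
have sZf1 : sm U3 (fun t => Z t *m f1 t) by exact: smM.
have sZf2 : sm U3 (fun t => Z t *m f2 t) by exact: smM.
have sZf3 : sm U3 (fun t => Z t *m f3 t) by exact: smM.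
have sZf4 : sm U3 (fun t => Z t *m f4 t) by exact: smM.
split=> //; first by apply: subset_trans sU1; apply: subset_trans sU2.
split; first by lia.
  by split=> //; exact: sm_row.
move=> t Ut; have Ut2 := sU3 t Ut.
have [[e22 e23 e24 e33 [e34 e44]] [a23 a24 a34 a44] u33 anti [g1 [g2 [g3 [g4 Hg]]]]] := Hf t Ut.
have [_ uW _ _ _] := H t (sU2 t Ut2).
have eW e (X : R -> 'M[R]_(n, e)) : eF E X W t = 0 by apply: eF_ker; exact: EW.
have eV e (X : R -> 'M[R]_(n, e)) : eF E X V t = 0 by apply: eF_ker; exact: EV.
have We e (X : R -> 'M[R]_(n, e)) : eF E W X t = 0 by apply: (eF_kerl _ sk) => //; exact: EW.
have Ve e (X : R -> 'M[R]_(n, e)) : eF E V X t = 0 by apply: (eF_kerl _ sk) => //; exact: EV.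
have aZW e (X : R -> 'M[R]_(d, e)) : aF E A (fun s => Z s *m X s) W t = 0.
  by rewrite aF_mull ZW ?mulmx0.
have aZV e (X : R -> 'M[R]_(d, e)) : aF E A (fun s => Z s *m X s) V t = 0.
  by rewrite aF_mull ZV ?mulmx0.
have aWZ e (X : R -> 'M[R]_(d, e)) : sm U3 X -> aF E A W (fun s => Z s *m X s) t = 0.
  by move=> sX; rewrite (aF_mulr (U := U3)) // WZ // We !mul0mx subrr.
have aVZ e (X : R -> 'M[R]_(d, e)) : sm U3 X -> aF E A V (fun s => Z s *m X s) t = 0.
  by move=> sX; rewrite (aF_mulr (U := U3)) // VZ // Ve !mul0mx subrr.
split.
- split; last split; rewrite ?eF_row ?eF_rowr ?eF_reduced ?eW ?eV ?We ?Ve //.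
  + by rewrite e23 row_mx0.
  + by rewrite e24 row_mx0.
  + by rewrite e33 block_mx0.
  + by rewrite e34 block_mx0.
  by rewrite e44 block_mx0.
- split; rewrite ?aF_row ?aF_rowr ?(aF_reduced (U := U3)) ?aZW ?aZV ?aWZ ?aVZ //.
  + by rewrite a23 row_mx0.
  + by rewrite a24 row_mx0.
  + by rewrite a34 WV // block_mx0.
  by rewrite a44 VV // block_mx0.
- rewrite aF_row (aF_reduced (U := U3)) // aZW aWZ //.
  exact: unitmx_block_diag.
- rewrite eF_row aF_row eF_reduced (aF_reduced (U := U3)) // !eV YV // aZV.
  exact: antitriangular_border.
have [G1 [G2 [G3 [G4 HG]]]] := span t Ut2.
exists (col_mx G1 (g1 *m G2)), (g2 *m G2), (col_mx (g3 *m G2) G3), (col_mx (g4 *m G2) G4).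
rewrite !mul_row_col -[RHS]HG -[in RHS](mulmx1 (Z t)) -Hg !mulmxDr !mulmxDl !mulmxA.
set a := Y t *m G1; set b1 := _ *m g1 *m _; set b2 := _ *m g2 *m _.
set b3 := _ *m g3 *m _; set b4 := _ *m g4 *m _; set c := W t *m _; set e := V t *m _.
rewrite !addrA; congr (_ + _); rewrite -!addrA; do 4 congr (_ + _).
by rewrite addrC.
Qed.

End NormalFrames.

(** * From frames to the normal form *)

Section FromStatement.
Variable R : realType.
Implicit Types (U : set R).

Lemma derive1_dmx m n (M : R -> 'M[R]_(m, n)) (t : R) :
  derivable M t 1 -> derive1 M t = dmx M t.
Proof.
move=> dM; rewrite derive1E derive_mx //; apply/matrixP => i j.
by rewrite !mxE derive1E.
Qed.

Lemma mck1_derivable U m n (M : R -> 'M[R]_(m, n)) (t : R) :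
  mck 1 U M -> U t -> derivable M t 1.
Proof. by move=> cM Ut; apply/derivable_mxP => i j; have [+ _] := cM i j; apply. Qed.

Lemma mck1_derive1 U m n (M : R -> 'M[R]_(m, n)) (t : R) :
  mck 1 U M -> U t -> derive1 M t = dmx M t.
Proof. by move=> cM Ut; apply: derive1_dmx; exact: mck1_derivable cM Ut. Qed.

Lemma mck2_continuous_derive1 U m n (M : R -> 'M[R]_(m, n)) (t : R) :
  open U -> mck 2 U M -> U t -> {for t, continuous (derive1 M)}.
Proof.
move=> oU cM Ut; apply: differentiable_continuous; apply/derivable1_diffP.
apply: (@near_eq_derivable _ _ _ (dmx M)); last first.
  by apply: mck1_derivable Ut; exact: mck_dmx.
apply: near_open oU Ut _ => s Us.
by rewrite (mck1_derive1 _ Us) //; exact: mckW.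
Qed.

Lemma smooth_sm n (E : R -> 'M[R]_n) : smooth E -> sm setT E.
Proof.
move=> sE k; suff H vs : mck k setT (Defs.iterD vs E) by exact: (H [::]).
elim: k vs => [//|k IH] vs i j; have [_ dE] := sE vs.
have dEij t := (derivable_mxP (Defs.iterD vs E) t 1).1 (dE t 1) i j.
split=> //; apply: eq_ck (IH (1 :: vs) i j); first exact: openT.
by move=> t _; rewrite /= derive_mx // mxE derive1E.
Qed.

Lemma smooth0 n : smooth ((fun=> 0) : R -> 'cV[R]_n).
Proof.
move=> vs; suff -> : Defs.iterD vs ((fun=> 0) : R -> 'cV[R]_n) = fun=> 0.
  by split=> [|t v]; [exact: cst_continuous|exact: derivable_cst].
by elim: vs => //= v vs ->; apply/funext => t; rewrite derive_cst.
Qed.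

Lemma skew_adjoint_skew_on n (a b : R) (E A : R -> 'M[R]_n) :
  smooth E -> skew_adjoint a b E A -> skew_on `]a, b[%classic E A.
Proof.
move=> sE sk t /=; rewrite in_itv /= => /andP[at_ tb].
have /sk[ET AT] : a <= t <= b by rewrite !ltW.
by split=> //; rewrite AT derive1_dmx //; have [_] := sE [::]; apply.
Qed.

(** The support stays inside ]a, b[, so the function is a solution on [a, b] vanishing at a, like
    the zero solution. Class 2 is used because a second derivative makes the first one continuous,
    as [C1] demands. *)
Lemma regular_no_compact_sol n (a b : R) (E A : R -> 'M[R]_n) : a < b ->
  regular_pair a b E A -> no_compact_sol 2 `]a, b[%classic E A.
Proof.
move=> ab [_ [uni _]] x cx [c [d [sU x0]]] eqx.
have cxT : mck 2 setT x by exact: mck_extend sU x0 cx.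
have dx t : derive1 x t = dmx x t by apply: (@mck1_derive1 setT) => //; exact: mckW.
have out t : ~~ (a < t < b) -> ~~ (c <= t <= d).
  by apply: contra => /sU; rewrite /= in_itv.
have sol0 : dae_sol a b E A (fun=> 0) (fun=> 0).
  split; last by move=> t _; rewrite derive1E derive_cst !mulmx0 addr0.
  split=> [t|]; first exact: derivable_cst.
  have -> : derive1 (fun=> 0 : 'cV[R]_n) = (fun=> 0).
    by apply/funext => t; rewrite derive1E derive_cst.
  exact: cst_continuous.
have solx : dae_sol a b E A (fun=> 0) x.
  split.
    split=> [t|t]; first by apply: (@mck1_derivable setT) => //; exact: mckW.
    exact: (@mck2_continuous_derive1 setT _ _ _ _ openT cxT).
  move=> t _; rewrite addr0 dx; have [tab|/out o] := boolP (a < t < b).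
    by apply: eqx; rewrite /= in_itv.
  by rewrite (dmx_outside x0 o) x0 // !mulmx0.
move=> t; have [/sU|/x0 //] := boolP (c <= t <= d).
rewrite /= in_itv /= => /andP[at_ tb].
apply: (uni _ _ _ a (@smooth0 n) solx sol0).
- by rewrite lexx ltW.
- by apply: x0; apply: out; rewrite ltxx.
by rewrite !ltW.
Qed.

End FromStatement.

(** * Reading the blocks of the transformed pair off the frames *)

Section NormalForm.
Variable R : realType.
Implicit Types (U : set R).

(** The index map is left abstract and only its numerical value is fixed, which matches the offsets
    of [blk] whatever nesting of [row_mx] builds [Q]. *)
Definition is_columns n m k (Q : R -> 'M[R]_(n, m)) (o : nat) (F : R -> 'M[R]_(n, k)) :=
  exists2 f : 'I_k -> 'I_m, forall u, f u = (o + u)%N :> nat &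
    forall t, F t = colsub f (Q t).

Lemma blk_mxsub m1 m2 k1 k2 (M : 'M[R]_(m1, m2)) (f : 'I_k1 -> 'I_m1) (g : 'I_k2 -> 'I_m2)
    o1 o2 : (forall u, f u = (o1 + u)%N :> nat) -> (forall v, g v = (o2 + v)%N :> nat) ->
  blk M o1 o2 k1 k2 = mxsub f g M.
Proof. by move=> hf hg; apply/matrixP => u v; rewrite !mxE -hf -hg ent_in. Qed.

Lemma dmx_colsub n m k (Q : R -> 'M[R]_(n, m)) (f : 'I_k -> 'I_m) t :
  dmx (fun s => colsub f (Q s)) t = colsub f (dmx Q t).
Proof.
apply/matrixP => i j; rewrite !mxE; congr (derive1 _ t).
by apply/funext => s; rewrite mxE.
Qed.

Lemma tr_colsub n m k (f : 'I_k -> 'I_m) (Q : 'M[R]_(n, m)) :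
  (colsub f Q)^T = rowsub f Q^T.
Proof. by apply/matrixP => i j; rewrite !mxE. Qed.

Lemma mulmx_sub2 n1 n2 m k l (f : 'I_k -> 'I_n1) (g : 'I_l -> 'I_n2)
    (X : 'M[R]_(n1, m)) (Y : 'M[R]_(m, n2)) :
  rowsub f X *m colsub g Y = mxsub f g (X *m Y).
Proof. by apply/matrixP => i j; rewrite !mxE; apply: eq_bigr => s _; rewrite !mxE. Qed.

Lemma mul_rowsub n1 m p k (f : 'I_k -> 'I_n1) (X : 'M[R]_(n1, m)) (Y : 'M[R]_(m, p)) :
  rowsub f X *m Y = rowsub f (X *m Y).
Proof. by apply/matrixP => i j; rewrite !mxE; apply: eq_bigr => s _; rewrite !mxE. Qed.

Section Columns.
Variables (n m k1 k2 o1 o2 : nat) (E A : R -> 'M[R]_n) (Q : R -> 'M[R]_(n, m)).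
Variables (F : R -> 'M[R]_(n, k1)) (G : R -> 'M[R]_(n, k2)).
Hypotheses (HF : is_columns Q o1 F) (HG : is_columns Q o2 G).

Lemma blk_eF t : blk (eF E Q Q t) o1 o2 k1 k2 = eF E F G t.
Proof.
have [f hf Ff] := HF; have [g hg Gg] := HG.
by rewrite (blk_mxsub _ hf hg) /eF Ff Gg tr_colsub mul_rowsub mulmx_sub2.
Qed.

Lemma blk_dmx_eF t : blk (dmx (eF E Q Q) t) o1 o2 k1 k2 = dmx (eF E F G) t.
Proof.
have [f hf Ff] := HF; have [g hg Gg] := HG.
rewrite (blk_mxsub _ hf hg); apply/matrixP => u v; rewrite mxE [LHS]mxE [RHS]mxE.
congr (derive1 _ t); apply/funext => s.
by rewrite -blk_eF (blk_mxsub _ hf hg) [RHS]mxE.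
Qed.

Lemma blk_aF t : blk (aF E A Q Q t) o1 o2 k1 k2 = aF E A F G t.
Proof.
have [f hf Ff] := HF; have [g hg Gg] := HG.
have -> : G = fun s => colsub g (Q s) by apply/funext.
rewrite (blk_mxsub _ hf hg) /aF Ff dmx_colsub tr_colsub (mul_rowsub _ _ (A t)) (mul_rowsub _ _ (E t)) !mulmx_sub2.
by move: (_ *m Q t) (_ *m dmx Q t) => X Y; apply/matrixP => u v; rewrite !mxE.
Qed.

End Columns.

Lemma normal_frames_normal_form U n (E A : R -> 'M[R]_n) n1 p q n3 n4 w rs cs
    (F1 : R -> 'M[R]_(n, n1)) (F2 : R -> 'M[R]_(n, p + q))
    (F3 : R -> 'M[R]_(n, n3)) (F4 : R -> 'M[R]_(n, n4)) :
  open U -> sm U E -> sm U A -> skew_on U E A ->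
  normal_frames U E A w rs cs F1 F2 F3 F4 ->
  exists Q : R -> 'M[R]_n, sm U Q /\ forall t, U t -> Q t \in unitmx /\
    normal_form n1 p q n3 n4 w rs cs (eF E Q Q t) (aF E A Q Q t) (dmx (eF E Q Q) t).
Proof.
move=> oU sE sA sk [en [s1 s2 s3 s4] H]; subst n.
pose Q t := row_mx (row_mx (row_mx (F1 t) (F2 t)) (F3 t)) (F4 t).
exists Q; split; first by do 3!apply: sm_row => //.
have c1 : is_columns Q 0 F1.
  exists (fun u => lshift n4 (lshift n3 (lshift (p + q) u))) => // t.
  by apply/matrixP => i j; rewrite mxE !row_mxEl.
have c2 : is_columns Q n1 F2.
  exists (fun u => lshift n4 (lshift n3 (rshift n1 u))) => // t.
  by apply/matrixP => i j; rewrite mxE !row_mxEl row_mxEr.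
have c3 : is_columns Q (n1 + (p + q)) F3.
  exists (fun u => lshift n4 (rshift (n1 + (p + q)) u)) => // t.
  by apply/matrixP => i j; rewrite mxE row_mxEl row_mxEr.
have c4 : is_columns Q (n1 + (p + q) + n3) F4.
  exists (fun u => rshift (n1 + (p + q) + n3) u) => // t.
  by apply/matrixP => i j; rewrite mxE row_mxEr.
move=> t Ut; split.
  have [_ _ _ _ [G1 [G2 [G3 [G4 HG]]]]] := H t Ut.
  have : Q t *m col_mx (col_mx (col_mx G1 G2) G3) G4 = 1%:M by rewrite !mul_row_col.
  by move/mulmx1_unit => [].
have [[e22 e23 e24 e33 [e34 e44]] [a23 a24 a34 a44] u33 [_ _ hs anti] _] := H t Ut.
rewrite /normal_form !(blk_eF E c2 c2) !(blk_eF E c2 c3) !(blk_eF E c2 c4).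
rewrite !(blk_eF E c3 c2) !(blk_eF E c3 c3) !(blk_eF E c3 c4).
rewrite !(blk_eF E c4 c2) !(blk_eF E c4 c3) !(blk_eF E c4 c4) !(blk_eF E c1 c4).
rewrite !(blk_aF E A c2 c2) !(blk_aF E A c2 c3) !(blk_aF E A c2 c4).
rewrite !(blk_aF E A c3 c2) !(blk_aF E A c3 c3) !(blk_aF E A c3 c4).
rewrite !(blk_aF E A c4 c2) !(blk_aF E A c4 c3) !(blk_aF E A c4 c4).
rewrite !(blk_aF E A c1 c4) !(blk_aF E A c4 c1) !(blk_dmx_eF E c1 c4).
have tr0 d1 d2 (X : R -> 'M[R]_(_, d1)) (Y : R -> 'M[R]_(_, d2)) :
  eF E X Y t = 0 -> eF E Y X t = 0 by move=> XY; rewrite -(tr_eF sk) // XY trmx0.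
have cst0 d1 d2 (M : R -> 'M[R]_(d1, d2)) C : (forall u, U u -> M u = C) -> dmx M t = 0.
  by move=> MC; rewrite (eq_dmx oU Ut MC) dmx_cst.
have atr d1 d2 (X : R -> 'M[R]_(_, d1)) (Y : R -> 'M[R]_(_, d2)) : sm U X -> sm U Y ->
    (forall u, U u -> eF E X Y u = 0) -> aF E A X Y t = 0 -> aF E A Y X t = 0.
  by move=> sX sY; move/(aF_transpose_eq0 oU sE sA sk sX sY); apply.
rewrite e22 e23 e24 e33 e34 e44 a23 a24 a34 a44.
rewrite (tr0 _ _ _ _ e23) (tr0 _ _ _ _ e24) (tr0 _ _ _ _ e34).
have E23 u : U u -> eF E F2 F3 u = 0 by move=> Uu; have [[]] := H u Uu.
have E24 u : U u -> eF E F2 F4 u = 0 by move=> Uu; have [[]] := H u Uu.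
have E33 u : U u -> eF E F3 F3 u = 0 by move=> Uu; have [[]] := H u Uu.
have E34 u : U u -> eF E F3 F4 u = 0 by move=> Uu; have [[_ _ _ _ []]] := H u Uu.
have E22 u : U u -> eF E F2 F2 u = signature_mx R p q by move=> Uu; have [[]] := H u Uu.
rewrite (atr _ _ F2 F3 s2 s3 E23 a23) (atr _ _ F2 F4 s2 s4 E24 a24).
rewrite (atr _ _ F3 F4 s3 s4 E34 a34).
(* The diagonal [eF] blocks of [F2] and [F3] are constant, so the derivative term drops and J and
   Sigma are truly skew; for A41 it stays and is the stated one. *)
rewrite (tr_aF oU sE sk s2 s2 Ut) (cst0 _ _ _ _ E22) subr0.
rewrite (tr_aF oU sE sk s3 s3 Ut) (cst0 _ _ _ _ E33) subr0.
rewrite (tr_aF oU sE sk s4 s1 Ut).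
do 20!split=> //; split; last split.
- move=> i k hi hk hik; apply/matrixP => u v; rewrite mxE [RHS]mxE.
  by have [+ _ _] := anti i k u v hi hk (ltn_ord u) (ltn_ord v); apply.
- move=> i k hi hk hik; apply/matrixP => u v; rewrite mxE [RHS]mxE.
  by have [_ + _] := anti i k u v hi hk (ltn_ord u) (ltn_ord v); apply.
move=> i k hi hk hik; split; first exact: hs.
apply/matrixP => u v; rewrite mxE [RHS]mxE.
by have [_ _] := anti i k u v hi hk (ltn_ord u) (ltn_ord v); apply.
Qed.

End NormalForm.

(** * Choice of the intervals *)

Section GreedyIntervals.
Variable R : realType.
Variables (good : R -> R -> Prop) (a b : R).
Hypothesis ab : a < b.
Hypothesis good_empty : good a a.
Hypothesis good_inside : forall c d, a <= c -> c < d -> d <= b ->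
  exists l r, [/\ c <= l, l < r, r <= d & good l r].

Let disj (x y : R * R) := forall t, x.1 < t < x.2 -> ~ (y.1 < t < y.2).

Let admissible (s : seq (R * R)) (x : R * R) :=
  [/\ a <= x.1, x.2 <= b, good x.1 x.2 & forall y, y \in s -> disj x y].

Let fits (s : seq (R * R)) (q : rat * rat) (x : R * R) :=
  admissible s x /\ [/\ x.1 < x.2, ratr q.1 <= x.1 & x.2 <= ratr q.2].

(* The k-th interval is chosen inside the k-th rational interval, disjoint
   from the previous ones, and is empty when there is no such choice. *)
Let choose s k : R * R :=
  if unpickle k is Some q then
    if pselect (exists x, fits s q x) is left H then projT1 (cid H) else (a, a)
  else (a, a).

Let Fixpoint chosen k : seq (R * R) :=
  if k is k'.+1 then choose (chosen k') k' :: chosen k' else [::].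

Let I k := choose (chosen k) k.

Lemma choose_admissible s k : admissible s (choose s k).
Proof.
have adm0 : admissible s (a, a).
  by split=> //=; [exact: ltW|move=> y _ t /= /andP[h1 h2]; have := lt_trans h1 h2; rewrite ltxx].
rewrite /choose; case: unpickle => // q; case: pselect => // H.
by case: (projT2 (cid H)).
Qed.

Lemma mem_chosen k x : x \in chosen k <-> exists2 j, (j < k)%N & x = I j.
Proof.
elim: k => [|k IH] /=; first by split=> // -[].
rewrite in_cons; split.
  case/orP => [/eqP ->|h]; first by exists k.
  by have [j jk ->] := IH.1 h; exists j => //; exact: ltnW.
case=> j jk xj; apply/orP; move: jk; rewrite ltnS leq_eqVlt => /orP[/eqP jk|jk].
  by left; rewrite xj jk.
by right; apply: IH.2; exists j.
Qed.

(** Take a rational interval inside ]u, v[ and its index k: either an earlier choice already meets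
    it, or a nonempty good interval inside it was available and the k-th choice is of that kind. *)
Lemma chosen_dense (u v : R) : a <= u -> u < v -> v <= b ->
  exists j t, u < t < v /\ (I j).1 < t < (I j).2.
Proof.
move=> au uv vb.
have [um mv] := midf_lt uv; set m := (u + v) / 2 in um mv.
have [q1] := rat_in_itvoo um; rewrite in_itv /= => /andP[uq1 q1m].
have [q2] := rat_in_itvoo mv; rewrite in_itv /= => /andP[mq2 q2v].
have q12 := lt_trans q1m mq2.
have [k pk] : exists k, unpickle k = Some (q1, q2) by exists (pickle (q1, q2)); exact: pickleK.
have [[j [jk [t [/andP[t1 t2] It]]]]|H] := pselect (exists j, (j < k)%N /\ exists t,
    ratr q1 < t < ratr q2 /\ (I j).1 < t < (I j).2).
  by exists j, t; split=> //; rewrite (lt_trans uq1) // (lt_trans t2).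
have [l [r [q1l lr rq2 glr]]] :
    exists l r, [/\ ratr q1 <= l, l < r, r <= ratr q2 & good l r].
  by apply: good_inside => //; [apply: le_trans au (ltW uq1)|apply: le_trans (ltW q2v) vb].
have ex : exists x, fits (chosen k) (q1, q2) x.
  exists (l, r); split; split=> //=.
  - by apply: le_trans q1l; apply: le_trans au (ltW uq1).
  - by apply: le_trans vb; apply: le_trans rq2 (ltW q2v).
  move=> y /mem_chosen[j jk ->] t /= /andP[lt tr] It; apply: H; exists j; split=> //.
  by exists t; split=> //; rewrite (le_lt_trans q1l) // (lt_le_trans tr).
have : fits (chosen k) (q1, q2) (I k).
  by rewrite /I /choose pk; case: pselect => // H'; exact: projT2 (cid H').
case=> _ [Ik q1I Iq2].
have [h1 h2] := midf_lt Ik.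
exists k, (((I k).1 + (I k).2) / 2); rewrite h1 h2; split=> //.
by rewrite (lt_trans uq1) ?(le_lt_trans q1I) //= (lt_trans _ q2v) // (lt_le_trans h2).
Qed.

Lemma exists_dense_disjoint_intervals : exists l r : nat -> R,
  (forall j k : nat, j <> k -> `]l j, r j[%classic `&` `]l k, r k[%classic = set0) /\
  closure (\bigcup_j `]l j, r j[%classic) = `[a, b]%classic /\
  forall j, good (l j) (r j).
Proof.
exists (fun j => (I j).1), (fun j => (I j).2); split; [|split].
- move=> j k jk; wlog lt_jk : j k jk / (j < k)%N.
    move=> W; have [|kj|//] := ltngtP j k; first exact: W.
    by rewrite setIC; apply: W => // /esym.
  rewrite -subset0 => t [] /=; rewrite !in_itv /= => Ij Ik.
  have [_ _ _ dis] := choose_admissible (chosen k) k.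
  by apply: (dis (I j) _ t) => //; apply/mem_chosen; exists j.
- apply/seteqP; split.
    have cl : closed (`[a, b]%classic : set R) by exact: itv_closed.
    rewrite (iffLR (closure_id _) cl).
    apply: closure_subset => t [j _] /=; rewrite !in_itv /= => /andP[h1 h2].
    have [aI Ib _ _] := choose_admissible (chosen j) j.
    by rewrite (le_trans aI (ltW h1)) (le_trans (ltW h2) Ib).
  move=> t /=; rewrite in_itv /= => /andP[at_ tb] B /nbhs_ballP[e /= e0 eB].
  (* The ball around t is clipped to [a, b]; it keeps a nonempty interior even when t is an
     endpoint. *)
  have h1 : a <= Num.max a (t - e) by rewrite le_max lexx.
  have h2 : Num.min b (t + e) <= b by rewrite ge_min lexx.
  have h3 : Num.max a (t - e) < Num.min b (t + e).
    rewrite gt_max !lt_min ab /= (le_lt_trans at_) ?ltrDl //=.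
    by rewrite (lt_le_trans _ tb) ?gtrBl //= (lt_trans (y := t)) ?gtrBl ?ltrDl.
  have [j [s [/andP[]]]] := chosen_dense h1 h3 h2.
  rewrite gt_max lt_min => /andP[as_ ts] /andP[sb st] Is.
  exists s; split; first by exists j; rewrite //= in_itv.
  by apply: eB; rewrite /ball /= distrC ltr_distl ts st.
by move=> j; have [] := choose_admissible (chosen j) j.
Qed.

End GreedyIntervals.

Lemma normal_form_inside (R : realType) (n : nat) (a b c d : R) (E A : R -> 'M[R]_n) :
  a < b -> smooth E -> smooth A -> regular_pair a b E A -> skew_adjoint a b E A ->
  a <= c -> c < d -> d <= b -> exists l r, [/\ c <= l, l < r, r <= d &
    exists (Q : R -> 'M[R]_n) (n1 p q n3 n4 w : nat) (rs cs : nat -> nat),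
      n = (n1 + (p + q) + n3 + n4)%N /\
      n1 = (\sum_(i < w) rs i)%N /\ n4 = (\sum_(k < w) cs k)%N /\
      (forall t, l < t < r -> derivable Q t 1 /\ {for t, continuous (derive1 Q)}) /\
      forall t, l < t < r ->
        Q t \in unitmx /\
        normal_form n1 p q n3 n4 w rs cs
          ((Q t)^T *m E t *m Q t)
          ((Q t)^T *m A t *m Q t - (Q t)^T *m E t *m derive1 Q t)
          (derive1 (fun s => (Q s)^T *m E s *m Q s) t)].
Proof.
move=> ab smE smA reg skew ac cd db.
pose U : set R := `]c, d[%classic.
have UI : U `<=` `]a, b[%classic.
  move=> t; rewrite /U /= !in_itv /= => /andP[h1 h2].
  by rewrite (le_lt_trans ac h1) (lt_le_trans h2 db).
have oU : open U by exact: itv_open.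
have U0 : U !=set0.
  by have [h1 h2] := midf_lt cd; exists ((c + d) / 2); rewrite /U /= in_itv /= h1.
have sE : sm U E by apply: sm_sub (smooth_sm smE).
have sA : sm U A by apply: sm_sub (smooth_sm smA).
have sk : skew_on U E A by apply: skew_on_sub UI _; exact: skew_adjoint_skew_on.
have nc : no_compact_sol 2 U E A.
  by apply: no_compact_sol_sub UI _; exact: regular_no_compact_sol.
have [U' [n1 [p [q [n3 [n4 [w [rs [cs [F1 [F2 [F3 [F4 [oU' U'0 sU frm]]]]]]]]]]]]]] :=
  exists_normal_frames (leqnn n) oU U0 sE sA sk nc.
have sE' := sm_sub sU sE; have sA' := sm_sub sU sA; have sk' := skew_on_sub sU sk.
have [Q [sQ HQ]] := normal_frames_normal_form oU' sE' sA' sk' frm.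
(* The size equations are part of the pointwise condition [antitriangular], so they are extracted at
   some point of [U']. *)
have [en _ H] := frm; have [t0 /H[_ _ _ [e1 e4 _ _] _]] := U'0.
have [l [r [lr lrU]]] := ex_itv_open oU' U'0.
have itvU t : l < t < r -> U' t by move=> /andP[h1 h2]; apply: lrU; rewrite !ltW.
exists l, r; split=> //.
- have /lrU/sU : l <= l <= r by rewrite lexx ltW.
  by rewrite /U /= in_itv /= => /andP[/ltW].
- have /lrU/sU : l <= r <= r by rewrite lexx ltW.
  by rewrite /U /= in_itv /= => /andP[_ /ltW].
exists Q, n1, p, q, n3, n4, w, rs, cs; do 3!split=> //; split.
  move=> t /itvU Ut; split; first exact: mck1_derivable (sQ 1%N) Ut.
  exact: mck2_continuous_derive1 oU' (sQ 2%N) Ut.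
move=> t /itvU Ut; rewrite (mck1_derive1 (sQ 1%N) Ut).
by rewrite (mck1_derive1 (sm_eF oU' sE' sQ sQ 1%N) Ut); exact: HQ.
Qed.

Theorem theorem4p3 (R : realType) (n : nat) (a b : R) (E A : R -> 'M[R]_n) :
  a < b ->
  smooth E -> smooth A ->
  regular_pair a b E A ->
  skew_adjoint a b E A ->
  exists l r : nat -> R,
    (* the open intervals I_j = ]l j, r j[ are pairwise disjoint *)
    (forall j k : nat, j <> k -> `]l j, r j[%classic `&` `]l k, r k[%classic = set0) /\
    (* the closure of their union is I = [a,b] *)
    closure (\bigcup_j `]l j, r j[%classic) = `[a, b]%classic /\
    forall j : nat,
      exists (Q : R -> 'M[R]_n) (n1 p q n3 n4 w : nat) (rs cs : nat -> nat),
        n = (n1 + (p + q) + n3 + n4)%N /\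
        n1 = (\sum_(i < w) rs i)%N /\ n4 = (\sum_(k < w) cs k)%N /\
        (* Q continuously differentiable on I_j *)
        (forall t, l j < t < r j -> derivable Q t 1 /\ {for t, continuous (derive1 Q)}) /\
        forall t, l j < t < r j ->
          Q t \in unitmx /\
          normal_form n1 p q n3 n4 w rs cs
            ((Q t)^T *m E t *m Q t)
            ((Q t)^T *m A t *m Q t - (Q t)^T *m E t *m derive1 Q t)
            (derive1 (fun s => (Q s)^T *m E s *m Q s) t).
Proof.
move=> ab smE smA reg skew.
apply: (@exists_dense_disjoint_intervals _ _ a b ab _
  (fun c d => @normal_form_inside R n a b c d E A ab smE smA reg skew)).
(* On the empty interval ]a, a[ only the size equations matter; p = n satisfies them. *)
exists (fun=> 0), 0%N, n, 0%N, 0%N, 0%N, 0%N, (fun=> 0%N), (fun=> 0%N).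
have empty t : a < t < a = false by apply/negbTE/negP => /andP[h /(lt_trans h)]; rewrite ltxx.
by rewrite !big_ord0 !addn0; do 3!split=> //; split=> t; rewrite empty.
Qed.
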